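(* Suppose that $P\subset M$ is a polytope lying on an affine hyperplane (there are $v\in N$ and a real number $r\neq0$ with $p\cdot v=r$ for all $p\in P$), with normal fan $\Sigma$. For any finite $\mathcal{A}\subset P$ with $\mathrm{conv}(\mathcal{A})=P$, there is an injective map of irrational toric varieties $\Psi_{\mathcal{A}}$ from $Y_\Sigma$ to the standard simplex $S^{\mathcal{A}}=\{x\in\mathbb{R}^{\mathcal{A}}_\geq\mid\sum_{a}x_a=1\}$ whose image is the projective irrational toric variety $Z_{\mathcal{A}}$. The map $\Psi_{\mathcal{A}}$ composed with the algebraic moment map $\pi_{\mathcal{A}}$ is a homeomorphism $Y_\Sigma\xrightarrow{\ \sim\ }P$.
   Context: $M$ and $N$ are dual finite-dimensional real vector spaces with pairing $u\cdot v$; $\mathbb{R}_>$, $\mathbb{R}_\geq$ are the positive and nonnegative reals. A polyhedral cone is a set $\mathbb{R}_\geq v_1+\dots+\mathbb{R}_\geq v_k$; the dual of a cone $\sigma\subset N$ is $\sigma^\vee=\{u\in M\mid u\cdot v\geq0\ \forall v\in\sigma\}$. A face of $\sigma$ is a set $\{v\in\sigma\mid u\cdot v=0\}$ with $u\in\sigma^\vee$, and similarly for cones in $M$. A fan $\Sigma\subset N$ is a finite collection of polyhedral cones in $N$ closed under taking faces such that any two of its cones meet in a common face. A polytope is the convex hull of a finite set. For $v\in N$, the face of $P$ exposed by $v$ is the set where $u\mapsto u\cdot v$ is minimized on $P$. For a face $F$ of $P$, $\sigma_F\subset N$ is the polyhedral cone of all $v$ that expose a face containing $F$; the (inner) normal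 fan of $P$ is the collection of all $\sigma_F$. $T_N$ is $N$ as a multiplicative group, identified with the group of continuous homomorphisms $M\to\mathbb{R}_>$ by $v\mapsto\gamma_v$, $\gamma_v(u)=\exp(-u\cdot v)$; for $t=\gamma_v$ write $t^u=\gamma_v(u)$. For a polyhedral cone $C\subset M$, $\mathrm{Hom}_c(C,\mathbb{R}_\geq)$ is the set of monoid homomorphisms $\varphi\colon(C,+)\to(\mathbb{R}_\geq,\times)$ (so $\varphi(0)=1$) that are continuous on the relative interior of each face of $C$, with the weakest topology making all evaluations at points of $C$ continuous. $T_N$ acts by $(t.\varphi)(u)=t^u\varphi(u)$. For $\sigma\in\Sigma$ put $V_\sigma=\mathrm{Hom}_c(\sigma^\vee,\mathbb{R}_\geq)$. For $\tau$ a face of $\sigma$, restriction from $\tau^\vee$ to $\sigma^\vee$ gives a $T_N$-equivariant inclusion $V_\tau\hookrightarrow V_\sigma$. The irrational toric variety $Y_\Sigma=\bigcup_{\sigma\in\Sigma}V_\sigma$ is obtained by gluing the $V_\sigma$ along these inclusions, with its $T_N$-action. $\mathbb{R}^{\mathcal{A}}_\geq$, $\mathbb{R}^{\mathcal{A}}_>$ are the tuples of nonnegative, resp. positive, reals indexed by $\mathcal{A}$. Let $\varphi_{\mathcal{A}}\colon T_N\to\mathbb{R}^{\mathcal{A}}_>$ be $t\mapsto(t^a\mid a\in\mathcal{A})$, and let $Y_{\mathcal{A}}$ be the closure of its image in $\mathbb{R}^{\mathcal{A}}_\geq$; it is a union of rays because of the affine hyperplane condition. Put $Z_{\mathcal{A}}=Y_{\mathcal{A}}\cap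 S^{\mathcal{A}}$. The simplex $S^{\mathcal{A}}$ is identified with the set of rays of $\mathbb{R}^{\mathcal{A}}_\geq$ and is regarded as an irrational toric variety with the action of the torus $\mathbb{R}^{\mathcal{A}}_>$ induced from coordinatewise multiplication on rays. A map of irrational toric varieties is a continuous map $\psi$ together with a homomorphism $\Psi$ of topological groups between the tori, such that $\psi(t.y)=\Psi(t).\psi(y)$. The algebraic moment map is $\pi_{\mathcal{A}}(x)=\sum_{a\in\mathcal{A}}x_a\,a$, a map from $Z_{\mathcal{A}}$ to $\mathrm{conv}(\mathcal{A})$. *)

(* Defs.v *)
From HB Require Import structures.
From Stdlib Require Import Relation_Operators.
From mathcomp Require Import all_boot all_order all_algebra sesquilinear finmap.
From mathcomp Require Import generic_quotient.
From mathcomp Require Import all_classical all_reals all_analysis.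
Set Implicit Arguments.
Unset Strict Implicit.
Unset Printing Implicit Defensive.
Import Order.TTheory GRing.Theory Num.Theory.
Import numFieldNormedType.Exports.
Local Open Scope classical_set_scope.
Local Open Scope ring_scope.

(* The usual topology of a finite-dimensional real vector space, transported   *)
(* from R^n by coordinates; it does not depend on the basis.                   *)
Definition euclidean {R : realType} (V : vectType R) : topologicalType :=
  initial_topology (passmx.rVof (vbasis {:V})).

Definition homeomorphism {X Y : topologicalType} (f : X -> Y) : Prop :=
  exists g : Y -> X, [/\ continuous f, continuous g, cancel f g & cancel g f].

Section Convexity.
Context {R : realType} {V : vectType R}.
Implicit Types C : set V.

Definition affine_hull C : set V :=
  [set x | exists n (a : 'I_n -> V) (c : 'I_n -> R),
    [/\ forall i, C (a i), \sum_i c i = 1 & x = \sum_i c i *: a i]].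

Definition convex_hull C : set V :=
  [set x | exists n (a : 'I_n -> V) (c : 'I_n -> R),
    [/\ forall i, C (a i), forall i, 0 <= c i, \sum_i c i = 1
      & x = \sum_i c i *: a i]].

Definition is_polytope (P : set V) : Prop :=
  exists2 S : set V, finite_set S & P = convex_hull S.

Definition relint C : set V :=
  [set x | C x /\ within (affine_hull C) (nbhs (x : euclidean V)) C].

End Convexity.

(* Both notions are used on each side of the pairing of M and N.               *)
Section Cones.
Context {R : realType} {U W : vectType R} (b : U -> W -> R).

Definition dual_cone (C : set W) : set U :=
  [set u | forall w, C w -> 0 <= b u w].

Definition is_face (F C : set W) : Prop :=
  exists2 u, dual_cone C u & F = C `&` [set w | b u w = 0].

End Cones.

Section NormalFan.
Context {R : realType} {M N : vectType R}.
Variables (B : {bilinear M -> N -> R | *%R & *%R}) (P : set M).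

Definition perfect_pairing : Prop :=
  (forall u, (forall v, B u v = 0) -> u = 0) /\
  (forall v, (forall u, B u v = 0) -> v = 0).

Definition exposed_face (v : N) : set M :=
  [set p | P p /\ forall q, P q -> B p v <= B q v].

Definition normal_cone (F : set M) : set N :=
  [set v | F `<=` exposed_face v].

(* If P is nonempty then so are its exposed faces; the nonemptiness clause     *)
(* only makes the normal fan of the empty polytope empty.                      *)
Definition normal_fan : set (set N) :=
  [set sigma | exists v : N,
    exposed_face v !=set0 /\ sigma = normal_cone (exposed_face v)].

End NormalFan.

Section AffineToricVariety.
Context {R : realType} {M N : vectType R}.
Variable B : {bilinear M -> N -> R | *%R & *%R}.

(* Monoid homomorphisms C -> R_>= are encoded as functions on M that vanish    *)
(* outside C, so that pointwise convergence on M is the same as pointwise      *)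
(* convergence on C.                                                           *)
Definition hom_c (C : set M) : set {ptws M -> R} :=
  [set phi : M -> R |
    [/\ forall u, ~ C u -> phi u = 0,
        forall u, C u -> 0 <= phi u,
        phi 0 = 1,
        forall u w, C u -> C w -> phi (u + w) = phi u * phi w
      & forall F, is_face (fun v u => B u v) F C ->
          {within (relint F : set (euclidean M)),
            continuous (phi : euclidean M -> R)}]].

Definition chart (sigma : set N) : topologicalType := hom_c (dual_cone B sigma).

Definition character (v : N) (u : M) : R := expR (- B u v).

Lemma linear_euclidean_continuous (V : vectType R) (f : V -> R) :
  linear_for *%R f -> continuous (f : euclidean V -> R).
Proof.
move=> fL.
pose hf := GRing.isLinear.Build R V R _ f fL.
pose g : {linear V -> R | *%R} := HB.pack f hf.
pose e := vbasis {:V}.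
pose h (w : 'rV[R]_(\dim {:V})) : R := \sum_i w 0 i * g e`_i.
have -> : f = h \o passmx.rVof e.
  apply/funext => x; rewrite /h /=.
  have -> : f x = g x by [].
  rewrite {1}(coord_vbasis (memvf x)) linear_sum /=.
  apply: eq_bigr => i _; rewrite passmx.coord_rVof.
  by have := fL (passmx.rVof e x 0 i) e`_i 0; rewrite !addr0 [f 0](linear0 g) addr0.
move=> x; apply: (@continuous_comp (euclidean V) 'rV[R]_(\dim {:V}) R).
  exact: initial_continuous.
move: (passmx.rVof e x); rewrite /h.
apply: continuous_big => [|i _ y]; first exact: add_continuous.
exact: cvgMr_tmp (@coord_continuous R 1 _ 0 i y).
Qed.

Lemma character_continuous v : continuous (character v : euclidean M -> R).
Proof.
have lB : linear_for *%R (B ^~ v) by move=> c x y; rewrite linearPl.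
move=> u; apply: (@continuous_comp (euclidean M) R R).
  by apply: continuousN; exact: (linear_euclidean_continuous lB).
exact: continuous_expR.
Qed.

Lemma characterD v u w : character v (u + w) = character v u * character v w.
Proof. by rewrite /character linearDl opprD expRD. Qed.

Lemma hom_c_translate (C : set M) (v : N) (phi : M -> R) :
  hom_c C phi -> hom_c C (fun u => character v u * phi u).
Proof.
case=> phiC phi_ge0 phi0 phiD phi_cont; split.
- by move=> u /phiC ->; rewrite mulr0.
- by move=> u /phi_ge0; apply: mulr_ge0; exact: expR_ge0.
- by rewrite phi0 /character linear0l oppr0 expR0 mulr1.
- by move=> u w Cu Cw; rewrite characterD phiD// mulrACA.
move=> F /phi_cont phiF x; apply: cvgM; last exact: phiF.
exact: (continuous_subspaceT (@character_continuous v)).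
Qed.

Definition act_chart (sigma : set N) (v : N) (phi : chart sigma) :
    chart sigma :=
  SigSub (mem_set (hom_c_translate v (set_valP phi))).

End AffineToricVariety.

Section ToricVariety.
Context {R : realType} {M N : vectType R}.
Variables (B : {bilinear M -> N -> R | *%R & *%R}) (Sigma : set (set N)).

Definition charts : topologicalType := {sigma : Sigma & chart B (val sigma)}.

Definition act_charts (v : N) (x : charts) : charts :=
  existT _ (tag x) (act_chart v (tagged x)).

(* x lies in V_tau, y in V_sigma, tau is a face of sigma and y is the          *)
(* restriction of x to the dual of sigma.                                      *)
Definition glued (x y : charts) : Prop :=
  is_face B (val (tag x)) (val (tag y)) /\
  forall u, dual_cone B (val (tag y)) u ->
    set_val (tagged x) u = set_val (tagged y) u.

Definition glue_rel (x y : charts) : bool := `[< clos_refl_sym_trans _ glued x y >].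

Lemma glue_rel_equiv : equiv_class_of glue_rel.
Proof.
split=> [x|x y|y x z]; first by apply/asboolP; exact: rst_refl.
  by apply/asboolP/asboolP => h; exact: rst_sym.
by move=> /asboolP xy /asboolP yz; apply/asboolP; exact: rst_trans xy yz.
Qed.

Canonical glue_equiv := EquivRelPack glue_rel_equiv.

Local Open Scope quotient_scope.

Definition toric_variety : topologicalType :=
  quotient_topology {eq_quot glue_equiv}.

Lemma glue_rel_act v x y :
  glue_rel x y -> glue_rel (act_charts v x) (act_charts v y).
Proof.
move=> /asboolP h; apply/asboolP.
elim: h => {x y} [x y [xy E]|x|x y _|x y z _ xy _ yz].
- by apply: rst_step; split=> // u yu; congr (_ * _); exact: E.
- exact: rst_refl.
- exact: rst_sym.
- exact: rst_trans xy yz.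
Qed.

Definition act_toric (v : N) (y : toric_variety) : toric_variety :=
  \pi_toric_variety (act_charts v (repr y)).

Lemma act_toric_pi v x :
  act_toric v (\pi_toric_variety x) = \pi_toric_variety (act_charts v x).
Proof.
apply/eqmodP/glue_rel_act.
by have /eqmodP : \pi_toric_variety (repr (\pi_toric_variety x)) =
  \pi_toric_variety x by exact: reprK.
Qed.

End ToricVariety.

Section Simplex.
Variables (R : realType) (I : finType).

Definition nonneg_tuples : set {ptws I -> R} := [set x | forall i, 0 <= x i].

Definition pos_tuples : set {ptws I -> R} := [set x | forall i, 0 < x i].

Definition simplex : set {ptws I -> R} :=
  nonneg_tuples `&` [set x | \sum_i x i = 1].

Definition torus : topologicalType := pos_tuples.

Lemma mul_torus_subproof (s t : torus) :
  pos_tuples (fun i => set_val s i * set_val t i).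
Proof. by move=> i; apply: mulr_gt0; [exact: (set_valP s)|exact: (set_valP t)]. Qed.

Definition mul_torus (s t : torus) : torus :=
  SigSub (mem_set (mul_torus_subproof s t)).

Lemma act_simplex_subproof (t : torus) (x : simplex) :
  simplex (fun i => set_val t i * set_val x i /
                    \sum_j set_val t j * set_val x j).
Proof.
have t0 := set_valP t; have [x0 x1] := set_valP x.
have tx0 i : 0 <= set_val t i * set_val x i.
  by apply: mulr_ge0; [exact/ltW/t0|exact: x0].
split=> [i|/=]; first by apply: divr_ge0 => //; exact: sumr_ge0.
rewrite -mulr_suml divff// psumr_neq0//.
have : \sum_i set_val x i != 0 by rewrite x1 oner_neq0.
rewrite psumr_neq0; last by move=> i _; exact: x0.
move=> /hasP[i iI xi]; apply/hasP; exists i => //.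
by apply: mulr_gt0 => //; exact: t0.
Qed.

(* A point of the simplex stands for the ray through it, hence the rescaling.  *)
Definition act_simplex (t : torus) (x : simplex) : simplex :=
  SigSub (mem_set (act_simplex_subproof t x)).

End Simplex.

Arguments nonneg_tuples R I x : clear implicits.
Arguments pos_tuples R I x : clear implicits.
Arguments simplex R I x : clear implicits.

(* Equivariant maps: G and H are the tori, acting on X and Y.                  *)
Definition is_toric_map {G H X Y : topologicalType}
    (mulG : G -> G -> G) (mulH : H -> H -> H)
    (actX : G -> X -> X) (actY : H -> Y -> Y)
    (psi : X -> Y) (Psi : G -> H) : Prop :=
  [/\ continuous psi,
      continuous Psi,
      forall s t, Psi (mulG s t) = mulH (Psi s) (Psi t)
    & forall t x, psi (actX t x) = actY (Psi t) (psi x)].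

(* T_N is N itself, v being identified with the homomorphism character B v.    *)
Definition mul_TN {R : realType} {N : vectType R} (v w : euclidean N) :
  euclidean N := (v : N) + (w : N).

Section ProjectiveToricVariety.
Context {R : realType} {M N : vectType R}.
Variables (B : {bilinear M -> N -> R | *%R & *%R}) (A : {fset M}).

Definition monomial_map (v : N) : {ptws A -> R} :=
  fun a => character B v (val a).

Definition Y_variety : set {ptws A -> R} :=
  nonneg_tuples R A `&` closure (range monomial_map).

Definition Z_variety : set {ptws A -> R} := Y_variety `&` simplex R A.

Definition moment_map (x : {ptws A -> R}) : M := \sum_(a : A) x a *: val a.

End ProjectiveToricVariety.

Arguments Y_variety {R M N} B A.
Arguments Z_variety {R M N} B A.
Arguments moment_map {R M} A x.

(* Main.v *)
Require Import Defs.
From mathcomp Require Import all_boot all_order all_algebra sesquilinear finmap.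
From mathcomp Require Import all_classical all_reals all_analysis.
From mathcomp Require Import ring lra.
From Stdlib Require Import Relation_Operators.
Set Implicit Arguments.
Unset Strict Implicit.
Unset Printing Implicit Defensive.
Import Order.TTheory GRing.Theory Num.Theory.
Import numFieldNormedType.Exports.
Local Open Scope classical_set_scope.
Local Open Scope ring_scope.

(** Let [face_point B w s] be the point of the simplex whose coordinate at [a] is
    proportional to the character [s] if [a] minimizes [B _ w] on [A], and zero
    otherwise: a character restricted to the face of the polytope exposed by [w].
    The theorem holds because these points describe the three spaces at once.

    - They are the points of the projective variety ([Z_varietyP]).
    - A point [phi] of the chart of a cone sigma has coordinates proportional to
      [phi (a' - a)], where [a] in [A] lies on the face of the polytope that
      belongs to sigma.  These coordinates are those of a face point with [w] in
      sigma, and they determine [phi] ([chart_of_face_point]).  Two points of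
      different charts with the same coordinates are restrictions of one point
      in the chart of the normal cone of the face exposed by [w], hence are
      glued ([chart_coords_glue]).  So the coordinates identify the toric
      variety with the projective one.
    - The moment map sends them bijectively to the polytope, which is Birch's
      theorem.  Injectivity is strict monotonicity of the logarithm
      ([moment_map_inj]); a preimage of [p] is found by maximizing a monomial
      whose exponents are convex coefficients of [p] ([moment_map_surj]).

    The first two items have a common core: a point of the simplex is a face
    point as soon as it satisfies all binomial equations, with nonnegative real
    exponents, that the characters satisfy ([binomial_face_point]).  This is
    Farkas' lemma used twice, for the support and for the logarithms of the
    nonzero coordinates.  The equations pass to the closure of the torus orbit by
    continuity.  For a chart they follow from [phi (t *: u) = phi u `^ t]
    ([hom_cZ]): an additive function of a positive real variable is linear once
    it is continuous, and each open ray of a polyhedral cone lies in the relative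
    interior of one face ([exists_relint]), where [phi] is continuous.

    The hyperplane makes the binomial equations homogeneous ([hyperplane_sum]),
    so that they ignore normalization, and it allows a normalizing factor to be
    absorbed in a character ([face_point_Y_variety]).

    As the projective variety is compact, the inverse of the moment map is
    continuous ([compact_lift_continuous]).  The inverse of the coordinate map is
    continuous because it is given near each point by monomials in ratios of
    coordinates, where a coordinate that may vanish only has nonnegative
    exponents ([toric_coords_local_inverse]). *)

(** * Sums with Kronecker deltas *)

Section SumsOfCoefficients.

Lemma sum_delta {R : pzRingType} {V : lmodType R} (I : finType) (j : I) (f : I -> V) :
  \sum_i (i == j)%:R *: f i = f j.
Proof.
rewrite (bigD1 j)//= eqxx scale1r big1 ?addr0// => i /negbTE->.
exact: scale0r.
Qed.

Lemma sum_delta1 {R : pzRingType} (I : finType) (j : I) : \sum_i (i == j)%:R = 1 :> R.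
Proof.
have := sum_delta (V := R^o) j (fun=> 1).
by under eq_bigr do rewrite /GRing.scale /= mulr1.
Qed.

Lemma sum1_neq0 {R : nzRingType} (I : finType) (c : I -> R) :
  \sum_i c i = 1 -> exists i, c i != 0.
Proof.
move=> c1; apply: contrapT => /forallNP c0; move/eqP: c1.
rewrite big1 => [|i _]; first by rewrite eq_sym oner_eq0.
by have /negP := c0 i; rewrite negbK => /eqP.
Qed.

End SumsOfCoefficients.

(** * Farkas' lemma and solvability of linear systems *)

Section Farkas.
Context {R : realFieldType} {V W : lmodType R} (b : V -> W -> R).
Hypotheses (bl : forall w, scalar (b ^~ w)) (br : forall v, scalar (b v)).
Hypothesis b_nondeg : forall v, (forall w, b v w = 0) -> v = 0.

Let b0l w : b 0 w = 0.
Proof. by have := bl w (-1) 0 0; rewrite scaler0 addr0 mulN1r addNr. Qed.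

Let bNr v w : b v (- w) = - b v w.
Proof.
have b0 : b v 0 = 0 by have := br v (-1) 0 0; rewrite scaler0 addr0 mulN1r addNr.
by have := br v (-1) w 0; rewrite !addr0 b0 scaleN1r mulN1r addr0.
Qed.

(** Induction on the number of generators.  If the last generator [g j] is needed,
    some [x] is nonnegative on the other generators and negative on [u], hence
    negative on [g j]; subtracting multiples of [g j] projects all vectors to the
    kernel of [x], where the induction hypothesis applies. *)
Lemma farkas (I : eqType) (s : seq I) (g : I -> V) (u : V) : uniq s ->
  (forall w, (forall i, i \in s -> 0 <= b (g i) w) -> 0 <= b u w) ->
  exists c : I -> R, (forall i, 0 <= c i) /\ u = \sum_(i <- s) c i *: g i.
Proof.
elim: s g u => [|j s IHs] g u.
  move=> _ hu; exists (fun=> 0); split=> //; rewrite big_nil.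
  apply: b_nondeg => w; apply/le_anti/andP; split; last exact: hu.
  by rewrite -oppr_ge0 -bNr; exact: hu.
move=> /= /andP[js us] hu.
have sumE c k (h : I -> V) : \sum_(i <- j :: s) (if i == j then k else c i) *: h i =
    k *: h j + \sum_(i <- s) c i *: h i.
  rewrite big_cons eqxx; congr (_ + _); apply: eq_big_seq => i si.
  by case: eqP => // ij; rewrite -ij si in js.
have [hs|/existsNP[x /not_implyP[xs /negP]]] := pselect
    (forall w, (forall i, i \in s -> 0 <= b (g i) w) -> 0 <= b u w).
  have [c [c0 ->]] := IHs g u us hs.
  exists (fun i => if i == j then 0 else c i); split=> [i|]; first by case: eqP.
  by rewrite sumE scale0r add0r.
rewrite -ltNge => ux.
have kx : b (g j) x < 0.
  rewrite ltNge; apply/negP => jx; move: ux; rewrite ltNge => /negP; apply.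
  by apply: hu => i; rewrite inE => /orP[/eqP->//|]; exact: xs.
set k := b (g j) x in kx; have k0 : k != 0 by rewrite lt_eqF.
pose r v := v - (b v x / k) *: g j.
have bN v h c w : b (v - c *: h) w = b v w - c * b h w.
  by rewrite -scaleNr addrC bl mulNr addrC.
have bM v c w : b v (w - c *: x) = b v w - c * b v x.
  by rewrite -scaleNr addrC br mulNr addrC.
(* The projection [r] on vectors is adjoint to the projection of covectors to
   the kernel of [g j]. *)
have rE v w : b (r v) w = b v (w - (b (g j) w / k) *: x).
  by rewrite /r bN bM; field.
have [|c [c0 rc]] := IHs (r \o g) (r u) us.
  move=> w hw; rewrite rE; apply: hu => i; rewrite inE => /orP[/eqP->|si].
    by rewrite bM -/k divfK// subrr.
  by rewrite -rE; exact: hw.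
exists (fun i => if i == j then b u x / k - \sum_(i <- s) c i * (b (g i) x / k)
                 else c i); split=> [i|].
  case: eqP => // _; rewrite subr_ge0 (@le_trans _ _ 0)//.
    rewrite big_seq; apply: sumr_le0 => l sl; apply: mulr_ge0_le0 => //.
    by apply: mulr_ge0_le0; [exact: xs|rewrite invr_le0 ltW].
  by apply: mulr_le0; [exact: ltW|rewrite invr_le0 ltW].
rewrite sumE -[LHS](subrK ((b u x / k) *: g j)) -/(r u) rc /r /=.
rewrite scalerBl scaler_suml.
under eq_bigr do rewrite scalerBr scalerA.
by rewrite sumrB addrC addrA addrAC.
Qed.

(** Adding the opposites of the generators in [S] turns their coefficients into
    arbitrary reals and the inequalities into equations. *)
Lemma farkas_free (I : finType) (S : pred I) (g : I -> V) (u : V) :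
  (forall w, (forall i, 0 <= b (g i) w) -> (forall i, S i -> b (g i) w = 0) ->
     0 <= b u w) ->
  exists c : I -> R, (forall i, ~~ S i -> 0 <= c i) /\ u = \sum_i c i *: g i.
Proof.
move=> hu.
pose G (p : I + I) : V :=
  match p with inl i => g i | inr i => if S i then - g i else 0 end.
have bNl v w : b (- v) w = - b v w.
  by have := bl w (-1) v 0; rewrite !addr0 b0l addr0 scaleN1r mulN1r.
have [||c [c0 ->]] := @farkas _ (index_enum (I + I)%type) G u.
- exact: index_enum_uniq.
- move=> w hw; apply: hu => [i|i Si]; first exact: (hw (inl i) (mem_index_enum _)).
  apply/le_anti/andP; split; last exact: (hw (inl i) (mem_index_enum _)).
  by have := hw (inr i) (mem_index_enum _); rewrite /G Si bNl oppr_ge0.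
exists (fun i => c (inl i) - (if S i then c (inr i) else 0)); split=> [i /negbTE->|].
  by rewrite subr0.
rewrite big_sumType /= -big_split /=; apply: eq_bigr => i _.
by case: (S i); rewrite ?subr0 ?scaler0 ?addr0// scalerBl scalerN.
Qed.

End Farkas.

Section LinearSystem.
Context {R : realType} {M N : vectType R}.
Context (B : {bilinear M -> N -> R | *%R & *%R}).
Hypothesis B_nondeg : forall u, (forall v, B u v = 0) -> u = 0.

(** Alternative for linear systems, by Farkas' lemma in the product with [R]: a
    covector that vanishes on all [(g i, y i)] and is negative on [(0, 1)] rescales
    to a solution, and otherwise [(0, 1)] is a combination of the [(g i, y i)]. *)
Lemma dual_system (I : finType) (g : I -> M) (y : I -> R) :
  (forall c : I -> R, \sum_i c i *: g i = 0 -> \sum_i c i * y i = 0) ->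
  exists v, forall i, B (g i) v = y i.
Proof.
move=> gy.
pose b (p : M * R) (q : N * R) := B p.1 q.1 + p.2 * q.2.
have bl q : scalar (b ^~ q).
  by move=> k [p s] [p' s']; rewrite /b /= linearPl /= -[k *: s]/(k * s); ring.
have br p : scalar (b p).
  by move=> k [q s] [q' s']; rewrite /b /= linearPr /= -[k *: s]/(k * s); ring.
have bnd p : (forall q, b p q = 0) -> p = 0.
  case: p => p s ps; congr pair.
    by apply: B_nondeg => v; have := ps (v, 0); rewrite /b /= mulr0 addr0.
  by have := ps (0, 1); rewrite /b /= linear0r add0r mulr1.
apply: contrapT => nv.
have [w|c [_]] := @farkas_free _ _ _ b bl br bnd I xpredT (fun i => (g i, y i)) (0, 1).
  move=> _ /(_ _ erefl) hw; rewrite /b /= linear0l add0r mul1r leNgt.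
  (* The last coordinate [w.2] is negative, so dividing by its opposite is possible. *)
  apply/negP => w0; apply: nv; exists (- (w.2^-1) *: w.1) => i.
  rewrite linearZr /=; move: (hw i); rewrite /b /= => /eqP.
  rewrite addr_eq0 => /eqP ->; rewrite mulrN mulNr opprK mulrCA mulVf ?mulr1//.
  by rewrite lt_eqF.
move=> [].
have -> : (\sum_i c i *: (g i, y i)) = (\sum_i c i *: g i, \sum_i c i * y i).
  by elim/big_rec3: _ => // i a1 a2 a3 _ ->.
by case=> /esym/gy -> /eqP; rewrite oner_eq0.
Qed.

End LinearSystem.

(** * Monomials with real exponents *)

Section Monomials.
Context {R : realType}.

(** The absolute value is there because real powers extended to negative bases are
    discontinuous at 0. *)
Lemma continuous_norm_powR (c x : R) : 0 <= c \/ x != 0 ->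
  {for x, continuous (fun y => `|y| `^ c)}.
Proof.
have pos t : 0 < t -> {for t, continuous (fun y : R => y `^ c)}.
  move=> t0; apply/differentiable_continuous/derivable1_diffP.
  by apply: derivable_powR; rewrite in_itv /= t0.
have [->|x0 _] := eqVneq x 0; last first.
  apply: (@cvg_comp _ _ _ (@Num.norm R R) (fun y => y `^ c) _ (nbhs `|x|)).
    exact: norm_continuous.
  by apply: pos; rewrite normr_gt0.
case=> // c_ge0; have [->|c0] := eqVneq c 0.
  rewrite (_ : (fun y : R => _) = cst 1); first exact: cvg_cst.
  by apply/funext => y; rewrite powRr0.
have {c_ge0}c_gt0 : 0 < c by rewrite lt_def c0.
apply/cvgrPdist_lt => e e0 /=; rewrite normr0 powR0// near_simpl.
near=> y; rewrite sub0r normrN ger0_norm ?powR_ge0//.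
have -> : e = (e `^ c^-1) `^ c by rewrite -powRrM mulVf// powRr1// ltW.
apply: gt0_ltr_powR; rewrite ?nnegrE ?powR_ge0//.
by near: y; apply: (@nbhs0_lt R R); exact: powR_gt0.
Unshelve. all: by end_near. Qed.

Context {I : finType}.
Implicit Types z y c d l : I -> R.

(** Absolute values make the monomial continuous on the whole product space, see
    [continuous_norm_powR]; on nonnegative tuples they are invisible. *)
Definition monomial z c : R := \prod_i `|z i| `^ c i.

Lemma cvg_monomial {T : Type} (F : set_system T) {FF : Filter F}
    (f : T -> I -> R) z c :
  (forall i, f x i @[x --> F] --> z i) -> (forall i, 0 <= c i \/ z i != 0) ->
  monomial (f x) c @[x --> F] --> monomial z c.
Proof.
move=> fz zc; apply: cvg_big => [|i _]; first exact: mul_continuous.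
exact: (cvg_comp _ _ (fz i) (continuous_norm_powR (zc i))).
Qed.

Lemma monomialM z y c : monomial (fun i => z i * y i) c = monomial z c * monomial y c.
Proof.
by rewrite /monomial -big_split; apply: eq_bigr => i _; rewrite normrM powRM.
Qed.

Lemma monomial_expR c l : monomial (fun i => expR (l i)) c = expR (\sum_i c i * l i).
Proof.
rewrite expR_sum; apply: eq_bigr => i _.
by rewrite gtr0_norm ?expR_gt0// /powR gt_eqF ?expR_gt0// expRK.
Qed.

Lemma monomialE z c : (forall i, 0 <= z i) -> (forall i, z i = 0 -> c i = 0) ->
  monomial z c = expR (\sum_i c i * ln (z i)).
Proof.
move=> z0 zc; rewrite expR_sum; apply: eq_bigr => i _; rewrite ger0_norm//.
by rewrite /powR; case: eqP => [/zc->|//]; rewrite eqxx mul0r expR0.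
Qed.

Lemma monomial_scale k z c : k != 0 ->
  monomial (fun i => k * z i) c = `|k| `^ (\sum_i c i) * monomial z c.
Proof.
move=> k0; rewrite (monomialM (fun=> k)); congr (_ * _).
rewrite /monomial; elim/big_rec2: _ => [|i x y _ ->]; first by rewrite powRr0.
by rewrite powRD// normr_eq0 k0 implybT.
Qed.

End Monomials.

(** * Points of the simplex cut out by binomials *)

Section FacePoints.
Context {R : realType} {M N : vectType R}.
Context (B : {bilinear M -> N -> R | *%R & *%R}) (A : {fset M}).
Implicit Types (v w : N) (a b q : A) (z c d : A -> R).

Definition argmin w : pred A := fun a => [forall b : A, B (val a) w <= B (val b) w].

Lemma argminP w a : reflect (forall b, B (val a) w <= B (val b) w) (argmin w a).
Proof. exact: forallP. Qed.

Lemma argmin_edge w a b : argmin w a ->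
  (B (val b - val a) w == 0) = argmin w b.
Proof.
move=> /argminP wa; rewrite linearBl subr_eq0.
apply/eqP/argminP => [->//|wb]; apply/le_anti.
by rewrite wa wb.
Qed.

(** The coordinates of the points of the orbit of the face exposed by [w]. *)
Definition face_point w v : A -> R := fun a =>
  (argmin w a)%:R * character B v (val a) /
  \sum_b (argmin w b)%:R * character B v (val b).

(** The normalizing constant need not be computed: it is forced by the sum. *)
Lemma face_point_eq w v k z : \sum_a z a = 1 ->
  (forall a, z a = k * ((argmin w a)%:R * character B v (val a))) ->
  z = face_point w v.
Proof.
move=> z1 zE; apply/funext => a; rewrite zE /face_point mulrC; congr (_ * _).
have : k * \sum_b (argmin w b)%:R * character B v (val b) = 1.
  by rewrite -[RHS]z1 mulr_sumr; apply: eq_bigr => b _; rewrite zE.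
set D := \sum_b _; have [->|D0] := eqVneq D 0.
  by rewrite mulr0 => /esym/eqP; rewrite oner_eq0.
by move/(canRL (mulfK D0)); rewrite mul1r.
Qed.

(** The binomial equations of the toric ideal of [A], with real exponents. *)
Definition binomial_identities z : Prop := forall c d,
  (forall a, 0 <= c a) -> (forall a, 0 <= d a) ->
  \sum_a c a *: val a = \sum_a d a *: val a -> monomial z c = monomial z d.

Section Balanced.
Hypothesis B_nondeg : forall u, (forall v, B u v = 0) -> u = 0.
Variable z : A -> R.
Hypotheses (z0 : forall a, 0 <= z a) (z1 : \sum_a z a = 1).
Hypothesis z_bin : binomial_identities z.

(** Split [d] in its positive and negative parts and use the binomial equation
    between them.  The negative part lives on the support of [z], so its monomial
    is positive, and then so is the other one. *)
Lemma binomial_log_relation d : \sum_a d a *: val a = 0 ->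
  (forall a, z a = 0 -> 0 <= d a) ->
  (forall a, z a = 0 -> d a = 0) /\ \sum_a d a * ln (z a) = 0.
Proof.
move=> dA dz.
pose p a := Num.max (d a) 0; pose n a := Num.max (- d a) 0.
have dE a : d a = p a - n a.
  by rewrite /p /n; case: (lerP (d a) 0); case: (lerP (- d a) 0); lra.
have zn a : z a = 0 -> n a = 0.
  by move=> /dz da; rewrite /n; apply/max_idPr; rewrite oppr_le0.
have pn : monomial z p = monomial z n.
  apply: z_bin => [a|a|]; [by rewrite le_max lexx orbT| by rewrite le_max lexx orbT|].
  apply/eqP; rewrite -subr_eq0 -sumrB -[eqbRHS]dA; apply/eqP/eq_bigr => a _.
  by rewrite dE scalerBl.
have zp a : z a = 0 -> p a = 0.
  move=> za; apply/eqP; apply: contraT => pa.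
  have := expR_gt0 (\sum_a n a * ln (z a)).
  rewrite -monomialE// -pn /monomial (bigD1 a)//= za normr0 powR0// mul0r.
  by rewrite ltxx.
split=> [a za|]; first by rewrite dE zp// zn// subrr.
have := pn; rewrite !monomialE// => /expR_inj pnE.
under eq_bigr do rewrite dE mulrBl.
by rewrite sumrB pnE subrr.
Qed.

(** The support is the set of minimizers of some [w]: for each [b] outside of the
    support a covector is constant and minimal on the support, and larger at [b],
    for otherwise Farkas' lemma expresses the edge from [b] to the support by a
    relation that [binomial_log_relation] excludes; add these covectors.  On the
    support the logarithms respect all linear relations between the points of
    [A], so they come from a covector. *)
Lemma binomial_face_point : exists w v, z = face_point w v.
Proof.
have [a0 za0] := sum1_neq0 z1.
have sep b : exists w, [/\ forall q, 0 <= B (val q - val a0) w,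
    forall q, z q != 0 -> B (val q - val a0) w = 0
    & z b = 0 -> 0 < B (val b - val a0) w].
  have [zb|zb] := eqVneq (z b) 0; last first.
    by exists 0; split=> [q|q _|zb0]; rewrite ?linear0r//; case/eqP: zb.
  apply: contrapT => /forallNP nw.
  have [w hw Sw|c [c0 cE]] := @farkas_free _ _ _ B (fun w k x y => linearPl B w k x y)
      (fun u k x y => linearPr B u k x y) B_nondeg A (fun q => z q != 0)
      (fun q => val q - val a0) (val a0 - val b).
    rewrite leNgt -opprB linearNl oppr_lt0; apply/negP => wb.
    by apply: (nw w); split.
  (* The relation given by Farkas' lemma, moved to one side; its coefficient at [b]
     is positive although [b] is outside of the support. *)
  pose e q := c q + (q == b)%:R - (q == a0)%:R * (1 + \sum_q c q).
  have [||eS _] := @binomial_log_relation e.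
  - under eq_bigr do rewrite /e scalerBl scalerDl mulrC -scalerA.
    rewrite sumrB big_split /= -scaler_sumr !sum_delta scalerDl scale1r scaler_suml.
    have -> : \sum_q c q *: val q = val a0 - val b + \sum_q c q *: val a0.
      by rewrite cE -big_split /=; apply: eq_bigr => q _; rewrite -scalerDr subrK.
    by apply/eqP; rewrite subr_eq0 addrAC subrK.
  - move=> q zq; rewrite /e; have [qa|_] := eqVneq q a0.
      by rewrite -qa zq eqxx in za0.
    by rewrite mul0r subr0 addr_ge0// c0//= zq eqxx.
  - have := eS b zb; rewrite /e eqxx; have [ba|_] := eqVneq b a0.
      by rewrite -ba zb eqxx in za0.
    have : 0 <= c b by rewrite c0//= zb eqxx.
    by rewrite mul0r mulr1n; lra.
have [w_ /(_ _)wP] := choice sep.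
pose w := \sum_b w_ b.
have wE q : B (val q - val a0) w = \sum_b B (val q - val a0) (w_ b).
  by rewrite linear_sumr.
have wS q : argmin w q = (z q != 0).
  apply/idP/idP => [/argminP/(_ a0)|zq]; last first.
    apply/argminP => b; rewrite -subr_ge0 -linearBl.
    rewrite (_ : val b - val q = (val b - val a0) - (val q - val a0)); last first.
      by rewrite opprB addrA subrK.
    rewrite linearBl /= !wE [X in _ - X]big1 ?subr0.
      by apply: sumr_ge0 => i _; have [+ _ _] := wP i; apply.
    by move=> i _; have [_ + _] := wP i; apply.
  rewrite -subr_le0 -linearBl wE; apply: contraTneq => zq; rewrite -ltNge (bigD1 q)//=.
  rewrite ltr_pwDl//; first by have [_ _ +] := wP q; apply.
  by apply: sumr_ge0 => i _; have [+ _ _] := wP i; apply.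
have [|v vE] := @dual_system _ _ _ B B_nondeg A
  (fun a => if z a != 0 then val a - val a0 else 0)
  (fun a => if z a != 0 then ln (z a0) - ln (z a) else 0).
  move=> c cA; pose d a := if z a != 0 then c a else 0.
  pose e q := d q - (q == a0)%:R * (\sum_q d q).
  have [||_] := @binomial_log_relation e.
  - under eq_bigr do rewrite /e scalerBl mulrC -scalerA.
    rewrite sumrB -scaler_sumr sum_delta scaler_suml -sumrB -[RHS]cA.
    apply: eq_bigr => a _; rewrite /d.
    by case: ifP; rewrite ?scale0r ?subr0 ?scaler0 -?scalerBr.
  - move=> a za; rewrite /e /d za eqxx; have [aa|_] := eqVneq a a0.
      by rewrite -aa za eqxx in za0.
    by rewrite mul0r subr0.
  move=> /eqP; under eq_bigr do rewrite /e mulrBl -mulrA.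
  rewrite sumrB (sum_delta (V := R^o)) subr_eq0 => /eqP eE.
  rewrite (eq_bigr (fun a => d a * ln (z a0) - d a * ln (z a))) => [|a _].
    by rewrite sumrB -mulr_suml eE subrr.
  by rewrite /d; case: ifP; rewrite ?mulr0 ?mul0r ?subr0// mulrBr.
exists w, v; apply: (@face_point_eq w v (z a0 * expR (B (val a0) v))) => // a.
rewrite wS; have [->|za] := eqVneq (z a) 0; first by rewrite mul0r mulr0.
have zp q : z q != 0 -> z q \is Num.pos by move=> zq; rewrite posrE lt_def zq z0.
have := vE a; rewrite za linearBl /= => /(canRL (subrK _)) vaE.
rewrite mul1r /character vaE opprD opprB -mulrA -expRD addrCA subrr addr0.
by rewrite expRB !lnK ?zp// mulrC divfK.
Qed.
End Balanced.
End FacePoints.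

(** * The normal fan in terms of the finite set of generators *)

Section NormalFanCones.
Context {R : realType} {M N : vectType R}.
Context (B : {bilinear M -> N -> R | *%R & *%R}) (A : {fset M}).
Implicit Types (v w : N) (a b q : A) (c : A -> R).

Lemma convex_hull_fsetP (p : M) : convex_hull [set` A] p <->
  exists c, [/\ forall a, 0 <= c a, \sum_a c a = 1 & p = \sum_a c a *: val a].
Proof.
split=> [[n [x [k [xA k0 k1 ->]]]]|[c [c0 c1 ->]]]; last first.
  exists #|{: A}|, (fun i => val (enum_val i : A)), (fun i => c (enum_val i)).
  split=> [i|i||]; [exact: valP|exact: c0| |].
    by rewrite -[RHS]c1; apply/esym; apply: (big_enum_val (A := predT)).
  exact: (big_enum_val (A := predT) (fun a => c a *: val a)).
pose y i : A := [` xA i]%fset.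
exists (fun a => \sum_(i | y i == a) k i); split=> [a||].
- exact: sumr_ge0.
- by rewrite -k1 [in RHS](partition_big y xpredT).
rewrite (partition_big y xpredT)//=; apply: eq_bigr => a _.
by rewrite scaler_suml; apply: eq_bigr => i /eqP <-.
Qed.

Lemma argmin_exists v a : exists b, argmin B v b.
Proof.
exists [arg min_(b < a) B (val b) v]%O; apply/argminP => b.
by case: arg_minP => // i _; apply.
Qed.

(** The normal cone of the face exposed by [v], read on the points of [A] only
    ([normal_cone_argmin]). *)
Definition argmin_cone v : set N := [set w | forall a, argmin B v a -> argmin B w a].

Let P := convex_hull [set` A].

Lemma convex_hull_val a : P (val a).
Proof.
apply/convex_hull_fsetP; exists (fun q => (q == a)%:R).
by split=> [q||]; [exact: ler0n|exact: sum_delta1|rewrite sum_delta].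
Qed.

(** A face contains a convex combination exactly if it contains each point used
    with nonzero weight. *)
Lemma exposed_faceP v p : exposed_face B P v p <->
  exists c, [/\ forall a, 0 <= c a, \sum_a c a = 1, p = \sum_a c a *: val a
    & forall a, c a != 0 -> argmin B v a].
Proof.
have Bsum c : B (\sum_a c a *: val a) v = \sum_a c a * B (val a) v.
  by rewrite linear_sumlz; apply: eq_bigr => a _; rewrite linearZl.
split=> [[/convex_hull_fsetP[c [c0 c1 pE]] pmin]|[c [c0 c1 pE cmin]]].
  exists c; split=> // a ca; apply/argminP => b.
  have [m mmin] := argmin_exists v a.
  apply: le_trans (argminP _ _ _ mmin b).
  have : \sum_q c q * (B (val q) v - B (val m) v) <= 0.
    under eq_bigr do rewrite mulrBr.
    rewrite sumrB -mulr_suml c1 mul1r -Bsum -pE subr_le0 pmin//.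
    exact: convex_hull_val.
  have c_ge0 q : 0 <= c q * (B (val q) v - B (val m) v).
    by rewrite mulr_ge0// subr_ge0 (argminP _ _ _ mmin).
  move=> s0; have /psumr_eq0P/(_ a) : \sum_q c q * (B (val q) v - B (val m) v) = 0.
    by apply/le_anti; rewrite s0 sumr_ge0.
  move=> /(_ (fun q _ => c_ge0 q) erefl)/eqP.
  by rewrite mulf_eq0 (negbTE ca) subr_eq0 => /eqP ->.
split; first by apply/convex_hull_fsetP; exists c.
move=> q /convex_hull_fsetP[d [d0 d1 ->]]; rewrite pE !Bsum.
have [a ca] := sum1_neq0 c1.
have amin := argminP _ _ _ (cmin a ca).
rewrite (eq_bigr (fun q => c q * B (val a) v)) => [|b _].
  rewrite -mulr_suml c1 -d1 mulr_suml; apply: ler_sum => b _.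
  by rewrite ler_wpM2l.
have [->|cb] := eqVneq (c b) 0; first by rewrite !mul0r.
by congr (_ * _); apply/le_anti; rewrite amin (argminP _ _ _ (cmin b cb)).
Qed.

Lemma exposed_face_val v a : argmin B v a -> exposed_face B P v (val a).
Proof.
move=> va; apply/exposed_faceP; exists (fun q => (q == a)%:R); split=> [q|||q].
- exact: ler0n.
- exact: sum_delta1.
- by rewrite sum_delta.
- by have [->|] := eqVneq q a => //; rewrite eqxx.
Qed.

Lemma normal_cone_argmin v : normal_cone B P (exposed_face B P v) = argmin_cone v.
Proof.
apply/seteqP; split=> w vw; last first.
  move=> p /exposed_faceP[c [c0 c1 pE cv]].
  by apply/exposed_faceP; exists c; split=> // a /cv/vw.
move=> a va; apply/argminP => b.
have [_] := vw _ (exposed_face_val va); apply; exact: convex_hull_val.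
Qed.

Lemma normal_fanP (sigma : set N) : normal_fan B P sigma <->
  exists v a, argmin B v a /\ sigma = argmin_cone v.
Proof.
split=> [[v [[p /exposed_faceP[c [_ c1 _ cv]]] ->]]|[v [a [va ->]]]].
  have [a /cv va] := sum1_neq0 c1.
  by exists v, a; rewrite normal_cone_argmin.
by exists v; split; [exists (val a); exact: exposed_face_val|rewrite normal_cone_argmin].
Qed.

Hypothesis B_nondeg : forall u, (forall v, B u v = 0) -> u = 0.

(** Polyhedrality of the dual cones: the dual of a normal cone is generated by the
    edge vectors leaving a point of the face, and it contains the opposites of
    those that stay in the face. *)
Lemma dual_argmin_coneP v a0 (u : M) : argmin B v a0 ->
  dual_cone B (argmin_cone v) u <->
  exists c, (forall a, ~~ argmin B v a -> 0 <= c a) /\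
            u = \sum_a c a *: (val a - val a0).
Proof.
move=> va0; split=> [uC|[c [c0 ->]] w vw]; last first.
  rewrite linear_sumlz; apply: sumr_ge0 => a _; rewrite linearZl linearBl /=.
  have wa0 := argminP _ _ _ (vw _ va0).
  have [va|va] := boolP (argmin B v a).
    have /eqP : B (val a - val a0) w == 0 by rewrite argmin_edge; exact: vw.
    by rewrite linearBl => ->; rewrite mulr0.
  by apply: mulr_ge0; [exact: c0|rewrite subr_ge0; exact: wa0].
apply: (@farkas_free _ _ _ B (fun w k x y => linearPl B w k x y)
      (fun u k x y => linearPr B u k x y) B_nondeg) => w w0 Sw.
have wa0 : argmin B w a0 by apply/argminP => b; rewrite -subr_ge0 -linearBl.
by apply: uC => a /Sw/eqP; rewrite argmin_edge.
Qed.

Lemma dual_argmin_cone_edge v a0 a : argmin B v a0 ->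
  dual_cone B (argmin_cone v) (val a - val a0).
Proof.
by move=> va0 w /(_ a0 va0)/argminP wa0; rewrite linearBl subr_ge0.
Qed.

End NormalFanCones.

(** * Homomorphisms on finitely generated cones are powers along rays *)

Section Powers.
Context {R : realType}.

Lemma continuous_powR_exponent (x t : R) : t != 0 ->
  {for t, continuous (fun s => x `^ s)}.
Proof.
move=> t0; have [->|x0] := eqVneq x 0.
  apply: cvg_near_cst => /=; rewrite (powR0 t0).
  near=> s; rewrite powR0//; near: s.
  by apply: (@cvgr_neq0 R R R (nbhs t) _ id t).
rewrite (_ : (fun s => _) = fun s => expR (s * ln x)); last first.
  by apply/funext => s; rewrite /powR (negbTE x0).
apply: (@cvg_comp _ _ _ ( *%R^~ (ln x)) (@expR R) _ (nbhs (t * ln x))).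
  by apply: cvgMr_tmp; exact: cvg_id.
exact: continuous_expR.
Unshelve. all: by end_near. Qed.

(** Taking roots gives the equation at positive rationals.  Both sides are
    continuous, so if they differed at [t] they would differ on a neighbourhood,
    which contains a rational number.  A zero of [h] requires no separate case,
    since powers of 0 with positive exponent are 0. *)
Lemma multiplicative_powR (h : R -> R) :
  (forall t, 0 < t -> 0 <= h t) ->
  (forall s t, 0 < s -> 0 < t -> h (s + t) = h s * h t) ->
  (forall t, 0 < t -> {for t, continuous h}) ->
  forall t, 0 < t -> h t = h 1 `^ t.
Proof.
move=> h0 hD hcont.
have hn t n : 0 < t -> h (n.+1%:R * t) = h t ^+ n.+1.
  move=> t0; elim: n => [|n IHn]; first by rewrite mul1r.
  by rewrite -addn1 natrD mulrDl mul1r hD// ?mulr_gt0// IHn -exprSr addn1.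
have hq (m n : nat) : h (m.+1%:R / n.+1%:R) = h 1 `^ (m.+1%:R / n.+1%:R).
  have n0 : 0 < n.+1%:R^-1 :> R by rewrite invr_gt0.
  have /(congr1 (fun x => x `^ n.+1%:R^-1)) : h n.+1%:R^-1 ^+ n.+1 = h 1.
    by rewrite -hn// mulfV.
  rewrite -powR_mulrn ?h0// -powRrM mulfV// powRr1 ?h0// => hnE.
  by rewrite hn// hnE -powR_mulrn ?powR_ge0// -powRrM mulrC.
move=> t t0; apply: contrapT => /eqP; rewrite -subr_eq0 => ht.
have cont : {for t, continuous (fun s => h s - h 1 `^ s)}.
  by apply: cvgB; [exact: hcont|apply: continuous_powR_exponent; rewrite gt_eqF].
have htn : \forall s \near t, h s - h 1 `^ s != 0 by exact: cvgr_neq0 cont ht.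
have [e /= e0 eh] := (iffLR (nbhs_ballP _ _)) htn.
have [n _ /(_ _ (leqnn n)) /= ne] := near_infty_natSinv_lt (PosNum e0).
(* The next multiple of [1 / n.+1] above [t] lies in the ball. *)
have /andP[mt tm] := truncn_itv (mulr_ge0 (ltW t0) (ler0n R n.+1)).
have q0 : 0 < n.+1%:R :> R by [].
have : ball t e ((Num.truncn (t * n.+1%:R)).+1%:R / n.+1%:R).
  rewrite /ball /= distrC ger0_norm; last by rewrite subr_ge0 ler_pdivlMr// ltW.
  apply: le_lt_trans ne; rewrite lerBlDl ler_pdivrMr// mulrDl mulVf ?gt_eqF//.
  by rewrite -natr1 lerD2r.
by move/eh => /=; rewrite hq subrr eqxx.
Unshelve. all: by end_near. Qed.

End Powers.

Section EuclideanLines.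
Context {R : realType} {V : vectType R}.

Lemma line_continuous (x y : V) :
  continuous ((fun t => x + t *: y) : R -> euclidean V).
Proof.
apply: continuous_comp_initial => t.
pose r := passmx.rVof (vbasis {:V}).
rewrite (_ : _ \o _ = fun t => t *: r y + r x); last first.
  by apply/funext => s; rewrite -passmx.rVof_linear addrC.
by apply: cvgD; [apply: cvgZr_tmp; exact: cvg_id|exact: cvg_cst].
Qed.

End EuclideanLines.

Section FinitelyGeneratedCones.
Context {R : realType} {M N : vectType R}.
Context (B : {bilinear M -> N -> R | *%R & *%R}).
Hypothesis B_nondeg : forall u, (forall v, B u v = 0) -> u = 0.
Variables (sigma : set N) (I : finType) (S : pred I) (g : I -> M).
Let C := dual_cone B sigma.
Hypothesis CP : forall u, C u <->
  exists c, (forall i, ~~ S i -> 0 <= c i) /\ u = \sum_i c i *: g i.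

Lemma dual_coneD u w : C u -> C w -> C (u + w).
Proof. by move=> Cu Cw v sv; rewrite linearDl addr_ge0// ?Cu ?Cw. Qed.

Lemma dual_coneZ c u : 0 <= c -> C u -> C (c *: u).
Proof. by move=> c0 Cu v sv; rewrite linearZl /= mulr_ge0// Cu. Qed.

Lemma dual_cone_gen i : C (g i).
Proof.
apply/CP; exists (fun j => (j == i)%:R); split=> [j _|]; first exact: ler0n.
by rewrite sum_delta.
Qed.

Lemma dual_cone_genN i : S i -> C (- g i).
Proof.
move=> Si; apply/CP; exists (fun j => - (j == i)%:R); split=> [j Sj|].
  by have [ji|_] := eqVneq j i; [rewrite ji Si in Sj|rewrite oppr0].
by under eq_bigr do rewrite scaleNr; rewrite sumrN sum_delta.
Qed.

(** The smallest face of [C] that contains [u]: a generator lies on it exactly if a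
    small multiple can be subtracted from [u] without leaving [C].  For each
    generator Farkas' lemma gives either such a multiple or a covector that
    separates the generator from [u]; the sum of these covectors defines the face. *)
Lemma carrier_face u : C u -> exists w, [/\ forall x, C x -> 0 <= B x w,
  B u w = 0 & forall i, B (g i) w = 0 -> exists2 t, 0 < t & C (u - t *: g i)].
Proof.
move=> Cu.
have sep i : exists w, [/\ forall x, C x -> 0 <= B x w, B u w = 0
    & B (g i) w = 0 -> exists2 t, 0 < t & C (u - t *: g i)].
  apply: contrapT => /forallNP nw.
  pose h (j : I + 'I_1) := if j is inl j then g j else u.
  have [w w0 Sw|c [c0]] := @farkas_free _ _ _ B (fun w k x y => linearPl B w k x y)
      (fun u k x y => linearPr B u k x y) B_nondeg _
      (fun j => if j is inl j then S j else true) h (- g i).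
    rewrite linearNl oppr_ge0 leNgt; apply/negP => gw; apply: (nw w); split.
    - move=> _ /CP[c [c0 ->]]; rewrite linear_sumlz; apply: sumr_ge0 => j _.
      rewrite linearZl /=; have [Sj|Sj] := boolP (S j).
        by rewrite (Sw (inl j) Sj) mulr0.
      by rewrite mulr_ge0 ?c0//; exact: (w0 (inl j)).
    - exact: (Sw (inr ord0)).
    - by move=> gw0; rewrite gw0 ltxx in gw.
  rewrite big_sumType big_ord1 /= => cE.
  set cu := c (inr ord0) in cE; pose k := 1 + `|cu|.
  have k0 : 0 < k by rewrite ltr_pwDl.
  apply: (nw 0); split=> [x _||_]; rewrite ?linear0r//.
  exists k^-1; first by rewrite invr_gt0.
  have -> : u - k^-1 *: g i = k^-1 *: ((k + cu) *: u + \sum_j c (inl j) *: g j).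
    rewrite scalerDl -addrA [_ *: u + \sum_j _]addrC -cE scalerBr scalerA.
    by rewrite mulVf ?gt_eqF// scale1r.
  apply: dual_coneZ; first by rewrite invr_ge0 ltW.
  apply: dual_coneD; first apply: dual_coneZ => //.
    by rewrite /k -addrA addr_ge0// -lerBlDl sub0r lerNnormlW.
  by apply/CP; exists (c \o inl); split=> // j Sj; exact: (c0 (inl j)).
have [w_ wP] := choice sep.
have w0 i x : C x -> 0 <= B x (w_ i) by have [+ _ _] := wP i; apply.
exists (\sum_i w_ i); split=> [x Cx||i].
- by rewrite linear_sumr; apply: sumr_ge0 => i _; exact: w0.
- by rewrite linear_sumr big1// => i _; have [_ + _] := wP i.
rewrite linear_sumr => /psumr_eq0P/(_ i) gw; have [_ _] := wP i; apply.
by apply: gw => // j _; apply: w0; exact: dual_cone_gen.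
Qed.

(** Near [t *: u] in the affine hull of its carrier face, the displacement from
    [t *: u] has small coefficients on the generators of the face, and the amounts
    that can be subtracted from [u] compensate for the negative ones.  All points
    of the open ray have the same carrier face. *)
Lemma exists_relint u : C u -> exists w, (forall x, C x -> 0 <= B x w) /\
  forall t, 0 < t -> relint (C `&` [set x | B x w = 0]) (t *: u).
Proof.
move=> Cu; have [w [w0 uw gw]] := carrier_face Cu.
exists w; split=> // t t0; set F := _ `&` _.
have Ftu : F (t *: u).
  by split; [apply: dual_coneZ => //; exact: ltW|rewrite /= linearZl /= uw mulr0].
split=> //.
pose X := [seq g i | i <- enum I & B (g i) w == 0].
have XP k : (k < size X)%N -> exists2 e, 0 < e & C (u - e *: X`_k).
  by move=> /(mem_nth 0)/mapP[i]; rewrite mem_filter => /andP[/eqP/gw + _] ->.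
have XC k : (k < size X)%N -> C X`_k.
  by move=> /(mem_nth 0)/mapP[i _ ->]; exact: dual_cone_gen.
have Xw k : (k < size X)%N -> B X`_k w = 0.
  by move=> /(mem_nth 0)/mapP[i]; rewrite mem_filter => /andP[/eqP gwi _] ->.
have F_span x : F x -> x \in <<X>>%VS.
  case=> /CP[c [c0 xE]] xw; rewrite xE; apply: memv_suml => i _.
  have [->|ci] := eqVneq (c i) 0; first by rewrite scale0r mem0v.
  apply/memvZ/memv_span/map_f; rewrite mem_filter mem_enum andbT.
  have cg_ge0 j : 0 <= c j * B (g j) w.
    have [Sj|Sj] := boolP (S j); last first.
      by apply: mulr_ge0; [exact: c0|exact/w0/dual_cone_gen].
    rewrite (_ : B (g j) w = 0) ?mulr0//; apply/le_anti.
    rewrite w0 ?andbT; last exact: dual_cone_gen.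
    by rewrite -oppr_ge0 -linearNl; apply/w0/dual_cone_genN.
  have cg0 : \sum_j c j * B (g j) w = 0.
    rewrite -[RHS]xw xE linear_sumlz; apply: eq_bigr => j _; exact/esym/linearZl.
  have /eqP := psumr_eq0P (fun j _ => cg_ge0 j) cg0 (i := i) erefl.
  by rewrite mulf_eq0 (negbTE ci).
have aff_span x : affine_hull F x -> x \in <<X>>%VS.
  by case=> n [a [c [aF _ ->]]]; apply: memv_suml => i _; apply: memvZ; exact: F_span.
have [|e eP] := @choice _ _ (fun (k : 'I_(size X)) e => 0 < e /\ C (u - e *: X`_k)).
  by move=> k; have [e e0 Ce] := XP k (ltn_ord k); exists e.
(* The vectors [X] may be dependent; [coord] still provides linear, hence
   continuous, coefficients. *)
pose s (k : 'I_(size X)) (y : M) := coord (in_tuple X) k (y - t *: u).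
have near_s : \forall y \near (t *: u : euclidean M),
    forall k, `|s k y| < t * e k / (size X).+1%:R.
  apply: (@filter_forall _ _ (fun k y => `|s k y| < t * e k / (size X).+1%:R)
    (nbhs (t *: u : euclidean M))) => k.
  have lc : linear_for *%R (coord (in_tuple X) k) by move=> a x y; rewrite linearP.
  have /cvgrPdist_lt := @linear_euclidean_continuous R M _ lc (t *: u).
  have e0 : 0 < t * e k / (size X).+1%:R by rewrite divr_gt0// mulr_gt0//; case: (eP k).
  move=> /(_ _ e0); apply: filterS => y; rewrite distrC.
  by rewrite /s linearB.
apply: filterS near_s => y ys /aff_span yX.
have yE : y = t *: u + \sum_k s k y *: X`_k.
  rewrite -[LHS](subrK (t *: u)) addrC; congr (_ + _); apply: coord_span.
  by rewrite memvB// F_span.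
split; last first.
  rewrite /= yE linearDl linearZl /= uw mulr0 add0r linear_sumlz big1// => k _.
  by rewrite linearZl /= Xw ?mulr0.
move=> v sv; rewrite yE linearDl linearZl linear_sumlz /=.
have uv := Cu v sv; set U := B u v in uv *.
have key k : - (t * U / (size X).+1%:R) <= B (s k y *: X`_k) v.
  have -> : B (s k y *: X`_k) v = s k y * B X`_k v by rewrite linearZl.
  have [e0 /(_ v sv)] := eP k.
  rewrite linearBl linearZl /= subr_ge0 => eU.
  have x0 := XC k (ltn_ord k) v sv.
  have /ltW := ys k; rewrite ler_norml => /andP[sk _].
  have : - (t * e k / (size X).+1%:R) * B X`_k v <= s k y * B X`_k v by rewrite ler_wpM2r.
  move=> se; apply: le_trans _ se; rewrite mulNr lerN2 mulrAC ler_wpM2r ?invr_ge0//.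
  by rewrite -mulrA ler_wpM2l// ltW.
rewrite -lerBlDl sub0r.
apply: (@le_trans _ _ (\sum_(k < size X) - (t * U / (size X).+1%:R))); last first.
  exact: ler_sum.
rewrite sumr_const card_ord mulNrn lerN2 -[_ *+ size X]mulr_natr -!mulrA.
rewrite ler_wpM2l ?(ltW t0)// ler_piMr//.
by rewrite mulrC ler_pdivrMr// mul1r ler_nat.
Qed.

Variable phi : M -> R.
Hypothesis phiC : hom_c B C phi.

(** The open ray through [u] lies in the relative interior of a face, where [phi] is
    continuous. *)
Lemma hom_cZ u t : C u -> 0 < t -> phi (t *: u) = phi u `^ t.
Proof.
move=> Cu t0; have [_ phi0 _ phiD phi_cont] := phiC.
rewrite -[in RHS](scale1r u).
apply: (multiplicative_powR (h := fun t => phi (t *: u))) t0 => [s s0|r s r0 s0|s s0].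
- by apply/phi0/dual_coneZ => //; exact: ltW.
- by rewrite scalerDl phiD//; apply: dual_coneZ => //; exact: ltW.
have [w [w0 wu]] := exists_relint Cu.
set F := _ `&` _ in wu.
have FC : is_face (fun v u => B u v) F C by exists w.
have phis := (iffLR (subspace_continuousP _ _)) (phi_cont F FC) _ (wu s s0).
have ray : {for s, continuous ((fun r : R => r *: u) : R -> euclidean M)}.
  have := @line_continuous R M 0 u s.
  rewrite (_ : (fun r => 0 + r *: u) = fun r => r *: u)//.
  by apply/funext => r; rewrite add0r.
apply: (cvg_comp _ _ _ phis) => U FU /=.
have s_gt0 : \forall r \near s, 0 < r by exact: lt_nbhsr.
by apply: filterS2 s_gt0 (ray _ FU) => r r0; apply; exact: wu.
Qed.

(** A homomorphism on a finitely generated cone is determined by its values on the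
    generators.  A negative exponent only occurs at a generator whose opposite is
    in the cone, where [phi] is nonzero. *)
Lemma hom_c_monomial c : (forall i, ~~ S i -> 0 <= c i) ->
  phi (\sum_i c i *: g i) = monomial (phi \o g) c.
Proof.
move=> c0; have [_ phi0 phi1 phiD _] := phiC.
have Cg i : C (c i *: g i).
  apply/CP; exists (fun j => (j == i)%:R * c i); split=> [j Sj|].
    by have [ji|_] := eqVneq j i; rewrite ?mul0r// mul1r -ji c0.
  by under eq_bigr do rewrite -scalerA; rewrite (sum_delta i (fun j => c i *: g j)).
rewrite /monomial.
suff [_ ->] : C (\sum_i c i *: g i) /\ phi (\sum_i c i *: g i) = \prod_i phi (c i *: g i).
  apply: eq_bigr => i _ /=; have Cgi := dual_cone_gen i.
  rewrite ger0_norm ?phi0//; case: (ltgtP (c i) 0) => [ci|ci|->]; last first.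
  - by rewrite scale0r phi1 powRr0.
  - exact: hom_cZ.
  have Si : S i by apply: contraTT ci => /c0; rewrite leNgt.
  have CNgi := dual_cone_genN Si.
  have phiN : phi (g i) * phi (- g i) = 1 by rewrite -phiD// subrr.
  have g_neq0 : phi (g i) != 0.
    by apply/eqP => gi; move: phiN; rewrite gi mul0r => /eqP; rewrite eq_sym oner_eq0.
  have phiNE : phi (- g i) = phi (g i) `^ (-1).
    by rewrite powR_inv1 ?phi0//; apply: (mulfI g_neq0); rewrite phiN mulfV.
  rewrite -[c i in LHS]opprK scaleNr -scalerN hom_cZ ?oppr_gt0//.
  by rewrite phiNE -powRrM mulN1r opprK.
elim/big_rec2: _ => [|i x y _ [Cx xE]].
  by split=> //; move=> v _; rewrite linear0l.
by split; [exact: (dual_coneD (Cg i) Cx)|rewrite phiD// xE].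
Qed.

End FinitelyGeneratedCones.

(** * Points of the affine charts *)

Section OrbitPoints.
Context {R : realType} {M N : vectType R}.
Context (B : {bilinear M -> N -> R | *%R & *%R}).

(** From a point of the relative interior one can move a little away from [x]
    inside of [C], and a linear form that is nonnegative on [C] and zero at [u]
    would become negative there if it were positive at [x]. *)
Lemma relint_face (C : set M) (u x : M) (w : N) : (forall y, C y -> 0 <= B y w) ->
  relint C u -> B u w = 0 -> C x -> B x w = 0.
Proof.
move=> Cw [Cu Cu_near] uw Cx; apply/le_anti; rewrite Cw// andbT.
have := @line_continuous R M u (u - x) 0.
rewrite /continuous_at scale0r addr0 => /(_ _ Cu_near).
rewrite near_simpl => /nbhs_ballP[e /= e0 eC].
have e2 : 0 < e / 2 by rewrite divr_gt0.
have : C (u + (e / 2) *: (u - x)).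
  apply: (eC (e / 2)).
    by rewrite /ball /= sub0r normrN gtr0_norm// ltr_pdivrMr// mulr_natr mulr2n ltrDl.
  exists 2%N, (fun i => if i == 0 then u else x),
    (fun i => if i == 0 then 1 + e / 2 else - (e / 2)); split=> [i||].
  - by case: ifP.
  - by rewrite big_ord_recl big_ord1 /=; ring.
  - by rewrite big_ord_recl big_ord1 /= scalerBr scalerDl scale1r scaleNr addrA.
move=> /Cw; rewrite linearDl linearZl linearBl /= uw add0r sub0r mulrN oppr_ge0.
by rewrite pmulr_rle0.
Qed.

(** The translate by [s] of the distinguished point of the orbit that belongs to the
    smallest face of [sigma] containing [w]. *)
Definition orbit_point (sigma : set N) (w s : N) : M -> R := fun u =>
  if `[< dual_cone B sigma u /\ B u w = 0 >] then character B s u else 0.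

(** On the relative interior of a face this function is either a character or zero,
    by [relint_face], hence continuous. *)
Lemma orbit_point_hom_c (sigma : set N) (w s : N) : sigma w ->
  hom_c B (dual_cone B sigma) (orbit_point sigma w s).
Proof.
move=> sw; have Cw u : dual_cone B sigma u -> 0 <= B u w by exact.
split.
- by move=> u nCu; rewrite /orbit_point asboolF// => -[].
- by move=> u _; rewrite /orbit_point; case: ifP => // _; exact: expR_ge0.
- have C0 : dual_cone B sigma 0 /\ B 0 w = 0 by split=> [v _|]; rewrite linear0l.
  by rewrite /orbit_point (asboolT C0) /character linear0l oppr0 expR0.
- move=> u x Cu Cx; have Cux := dual_coneD Cu Cx; rewrite /orbit_point.
  have uxw : B (u + x) w = B u w + B x w by rewrite linearDl.
  have [uw|uw] := eqVneq (B u w) 0; last first.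
    rewrite asboolF; last first.
      by move=> [_ /eqP]; rewrite uxw paddr_eq0 ?Cw// (negbTE uw).
    by rewrite [X in X * _]ifF ?mul0r//; apply/asboolP => -[_ /eqP]; apply/negP.
  have [xw|xw] := eqVneq (B x w) 0; last first.
    rewrite asboolF; last first.
      by move=> [_ /eqP]; rewrite uxw paddr_eq0 ?Cw// (negbTE xw) andbF.
    by rewrite [X in _ * X]ifF ?mulr0//; apply/asboolP => -[_ /eqP]; apply/negP.
  have uxw0 : B (u + x) w = 0 by rewrite uxw uw xw addr0.
  rewrite (asboolT (conj Cux uxw0)) (asboolT (conj Cu uw)) (asboolT (conj Cx xw)).
  exact: characterD.
move=> F [v vC FE].
have FC x : F x -> dual_cone B sigma x by rewrite FE => -[].
have [[u Fu uw]|nu] := pselect (exists2 u, relint F u & B u w = 0).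
  apply: (@subspace_eq_continuous _ _ _ (character B s : euclidean M -> R)).
    move=> x /set_mem[Fx _].
    have xw : B x w = 0 by apply: relint_face Fu uw Fx => y /FC /Cw.
    suff : character B s x = orbit_point sigma w s x by [].
    by rewrite /orbit_point (asboolT (conj (FC _ Fx) xw)).
  exact/continuous_subspaceT/character_continuous.
apply: (@subspace_eq_continuous _ _ _ (cst 0 : euclidean M -> R)); last first.
  exact/continuous_subspaceT/cst_continuous.
move=> x /set_mem Fx; suff : 0 = orbit_point sigma w s x by [].
rewrite /orbit_point asboolF// => -[_ xw].
by apply: nu; exists x.
Qed.

End OrbitPoints.

Section ChartCoordinates.
Context {R : realType} {M N : vectType R}.
Context (B : {bilinear M -> N -> R | *%R & *%R}) (A : {fset M}).
Implicit Types (v w s : N) (a b q : A) (c : A -> R) (phi : M -> R).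

Lemma face_point_denom_gt0 w s a :
  0 < \sum_(b : A) (argmin B w b)%:R * character B s (val b).
Proof.
have [m wm] := argmin_exists B w a.
have b_ge0 (b : A) : 0 <= (argmin B w b)%:R * character B s (val b).
  by rewrite mulr_ge0// expR_ge0.
rewrite lt_def sumr_ge0// andbT psumr_neq0//.
by apply/hasP; exists m; rewrite ?mem_index_enum// wm mul1r expR_gt0.
Qed.

Lemma face_point_neq0 w s a : (face_point B w s a != 0) = argmin B w a.
Proof.
rewrite /face_point !mulf_eq0 invr_eq0 (gt_eqF (face_point_denom_gt0 w s a)) orbF.
rewrite negb_or andbC gt_eqF ?expR_gt0//=.
by case: argmin; rewrite ?oner_eq0 ?eqxx.
Qed.

Lemma face_point_simplex w s a : simplex R A (face_point B w s).
Proof.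
have D0 := face_point_denom_gt0 w s a.
split=> [b|/=]; first by rewrite divr_ge0 ?(ltW D0)// mulr_ge0// expR_ge0.
by rewrite -mulr_suml mulfV// gt_eqF.
Qed.

(** The coordinates [phi a'], up to a factor, if [phi] were defined on all of [M];
    translating by [- a] moves [A] into the domain of [phi]. *)
Definition simplex_coords phi a : A -> R := fun b =>
  phi (val b - val a) / \sum_(q : A) phi (val q - val a).

Hypothesis B_nondeg : forall u, (forall v, B u v = 0) -> u = 0.

Section Chart.
Variables (v : N) (phi : M -> R).
Let C := dual_cone B (argmin_cone B A v).
Hypothesis phiC : hom_c B C phi.

Let edge a b : argmin B v a -> C (val b - val a).
Proof. exact: dual_argmin_cone_edge. Qed.

Let phi0 u : C u -> 0 <= phi u. Proof. by case: phiC => _ + _ _ _; apply. Qed.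

Lemma chart_denom_gt0 a : argmin B v a -> 0 < \sum_(q : A) phi (val q - val a).
Proof.
move=> va; have [_ _ phi1 _ _] := phiC.
rewrite (bigD1 a)//= subrr phi1 ltr_pwDl//; apply: sumr_ge0 => b _.
by apply: phi0; apply: edge.
Qed.

Lemma simplex_coordsP a : argmin B v a -> simplex R A (simplex_coords phi a).
Proof.
move=> va; have D0 := chart_denom_gt0 va; split=> [b|/=].
  by rewrite divr_ge0 ?(ltW D0)//; apply: phi0; apply: edge.
by rewrite -mulr_suml mulfV ?gt_eqF.
Qed.

Lemma simplex_coords_ratio a b : argmin B v a ->
  simplex_coords phi a b / simplex_coords phi a a = phi (val b - val a).
Proof.
move=> va; have [_ _ phi1 _ _] := phiC; have D0 := chart_denom_gt0 va.
by rewrite /simplex_coords subrr phi1 mul1r invrK divfK ?gt_eqF.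
Qed.

(** A difference of two points of the face is a unit of the dual cone, so [phi] is
    nonzero there, and changing the base point multiplies all coordinates by it. *)
Lemma simplex_coords_base a b : argmin B v a -> argmin B v b ->
  simplex_coords phi a = simplex_coords phi b.
Proof.
move=> va vb; have [_ _ phi1 phiD _] := phiC.
have shift q : phi (val q - val a) = phi (val q - val b) * phi (val b - val a).
  by rewrite -phiD ?addrA ?subrK//; exact: edge.
apply/funext => q; rewrite /simplex_coords shift.
under eq_bigr do rewrite shift.
have ba : phi (val b - val a) != 0.
  apply/eqP => ba; have := phi1; rewrite -(subrr (val a)) shift ba mulr0.
  by move/eqP; rewrite eq_sym oner_eq0.
by rewrite -mulr_suml invfM mulrACA mulfV// mulr1.
Qed.

Lemma simplex_coords_gt0 a b : argmin B v a -> argmin B v b ->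
  0 < simplex_coords phi a b.
Proof.
move=> va vb; have [_ _ phi1 _ _] := phiC.
rewrite (simplex_coords_base va vb) /simplex_coords subrr phi1 mul1r.
by rewrite invr_gt0 chart_denom_gt0.
Qed.

(** The inverse of the coordinate map on a chart. *)
Lemma chart_monomial a c : argmin B v a -> (forall b, ~~ argmin B v b -> 0 <= c b) ->
  phi (\sum_(b : A) c b *: (val b - val a)) =
  monomial (fun b => simplex_coords phi a b / simplex_coords phi a a) c.
Proof.
move=> va c0.
rewrite (hom_c_monomial B_nondeg (fun u => dual_argmin_coneP B_nondeg u va) phiC c0).
by congr monomial; apply/funext => b; rewrite simplex_coords_ratio.
Qed.

Hypothesis A_hyperplane : exists v0 r, r != 0 /\ forall a, B (val a) v0 = r.

(** The hyperplane turns every relation between points of [A] into a relation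
    between equally many of them. *)
Lemma hyperplane_sum c d : \sum_(a : A) c a *: val a = \sum_(a : A) d a *: val a ->
  \sum_(a : A) c a = \sum_(a : A) d a.
Proof.
have [v0 [r [r0 Ar]]] := A_hyperplane; move=> /(congr1 (B ^~ v0)).
have sumE (e : A -> R) : B (\sum_(a : A) e a *: val a) v0 = (\sum_(a : A) e a) * r.
  by rewrite linear_sumlz mulr_suml; apply: eq_bigr => a _; rewrite linearZl Ar.
by rewrite !sumE => /(mulIf r0).
Qed.

Lemma simplex_coords_binomial a : argmin B v a -> binomial_identities (simplex_coords phi a).
Proof.
move=> va c d c0 d0 cd; have [_ _ phi1 _ _] := phiC.
have scale e : monomial (simplex_coords phi a) e =
    `|simplex_coords phi a a| `^ (\sum_(b : A) e b) *
    monomial (fun b => simplex_coords phi a b / simplex_coords phi a a) e.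
  have aa0 : simplex_coords phi a a != 0 by rewrite gt_eqF// simplex_coords_gt0.
  rewrite -monomial_scale//; congr monomial; apply/funext => b.
  by rewrite mulrC divfK.
rewrite !scale -!chart_monomial// (hyperplane_sum cd); congr (_ * phi _).
under eq_bigr do rewrite scalerBr; under [RHS]eq_bigr do rewrite scalerBr.
by rewrite !sumrB cd -!scaler_suml (hyperplane_sum cd).
Qed.

End Chart.

Lemma chart_eq v phi phi' a : argmin B v a ->
  hom_c B (dual_cone B (argmin_cone B A v)) phi ->
  hom_c B (dual_cone B (argmin_cone B A v)) phi' ->
  simplex_coords phi a = simplex_coords phi' a -> phi = phi'.
Proof.
move=> va phiC phiC' E; apply/funext => u.
have [|nu] := pselect (dual_cone B (argmin_cone B A v) u); last first.
  by case: phiC phiC' => phiN _ _ _ _ [phiN' _ _ _ _]; rewrite phiN ?phiN'.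
case/(dual_argmin_coneP B_nondeg u va) => c [c0 ->].
by rewrite (chart_monomial phiC va c0) (chart_monomial phiC' va c0) E.
Qed.

(** The edge vectors on which [w] vanishes are those that lead to minimizers of [w]. *)
Lemma simplex_coords_orbit v w s a : argmin B v a -> argmin_cone B A v w ->
  simplex_coords (orbit_point B (argmin_cone B A v) w s) a = face_point B w s.
Proof.
move=> va vw; have oC := orbit_point_hom_c B s vw.
have [_ z1] := simplex_coordsP oC va.
apply: (face_point_eq (k := (expR (B (val a) s)) /
    \sum_(q : A) orbit_point B (argmin_cone B A v) w s (val q - val a)) z1) => b.
rewrite mulrAC; congr (_ / _); rewrite /orbit_point.
have wa := vw _ va.
have [wb|wb] := boolP (argmin B w b).
  have wab : B (val b - val a) w = 0 by apply/eqP; rewrite argmin_edge.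
  rewrite (asboolT (conj (dual_argmin_cone_edge b va) wab)) mul1r /character.
  by rewrite -expRD linearBl opprB addrC.
rewrite asboolF ?mul0r ?mulr0// => -[_ /eqP].
by rewrite argmin_edge// (negbTE wb).
Qed.

End ChartCoordinates.

(** * The projective variety *)

Lemma ptws_cvg (I : Type) (V : topologicalType) (T : Type) (F : set_system T)
    {FF : Filter F} (f : T -> I -> V) (l : I -> V) :
  (forall i, f t i @[t --> F] --> l i) -> f t @[t --> F] --> (l : {ptws I -> V}).
Proof.
move=> fl; apply/cvg_sup => i U [? /= [[W oW <-]]] /= Wl /filterS; apply.
by apply: (fl i); exact: open_nbhs_nbhs.
Qed.

Lemma ptws_eval_cvg (I : eqType) (V : topologicalType) (T : Type) (F : set_system T)
    {FF : Filter F} (f : T -> {ptws I -> V}) (l : {ptws I -> V}) i :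
  f t @[t --> F] --> l -> f t i @[t --> F] --> l i.
Proof.
move=> fl; have pl := @proj_continuous I (fun=> V) i l.
exact: (@cvg_comp _ _ _ f (proj i) F (nbhs l) (nbhs (l i)) fl pl).
Qed.

Section ProjectiveVariety.
Context {R : realType} {M N : vectType R}.
Context (B : {bilinear M -> N -> R | *%R & *%R}) (A : {fset M}).
Implicit Types (v w s : N) (a b q : A) (c : A -> R).

(** A binomial equation is a closed condition, and characters satisfy it. *)
Lemma Y_variety_binomial (z : {ptws A -> R}) : Y_variety B A z -> binomial_identities z.
Proof.
case=> z0 zcl c d c0 d0 cd; apply/eqP; apply: contraT; rewrite -subr_eq0 => zcd.
have cont e : (forall a, 0 <= e a) -> monomial x e @[x --> z] --> monomial z e.
  move=> e0; apply: (@cvg_monomial _ _ _ (nbhs z) (nbhs_filter z) id) => a; last by left.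
  exact: (@proj_continuous A (fun=> R) a z).
have czd : monomial x c - monomial x d @[x --> z] --> monomial z c - monomial z d.
  by apply: (@cvgB _ _ _ (nbhs z) (nbhs_filter z)); exact: cont.
have [_ [[v _ <-] /=]] := zcl _ (@cvgr_neq0 _ _ _ (nbhs z) (nbhs_filter z) _ _ czd zcd).
have vE e : monomial (monomial_map B (A := A) v) e = expR (- B (\sum_a e a *: val a) v).
  rewrite (monomial_expR e (fun a => - B (val a) v)); congr expR.
  by rewrite linear_sumlz -sumrN; apply: eq_bigr => a _; rewrite linearZl mulrN.
by rewrite !vE cd subrr eqxx.
Qed.

Hypothesis A_hyperplane : exists v0 r, r != 0 /\ forall a, B (val a) v0 = r.

(** Moving to infinity in the direction of [w] suppresses the coordinates outside of
    the face.  The hyperplane provides a direction [v0] that rescales all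
    coordinates simultaneously, which keeps the others normalized. *)
Lemma face_point_Y_variety w s a : Y_variety B A (face_point B w s).
Proof.
split; first by have [] := face_point_simplex B w s a.
have [v0 [r [r0 Ar]]] := A_hyperplane.
have [m wm] := argmin_exists B w a.
have D0 := face_point_denom_gt0 B w s a.
set D := \sum_(b : A) _ in D0.
pose x (n : nat) : N := s + n%:R *: w + ((ln D - n%:R * B (val m) w) / r) *: v0.
have xE n b : monomial_map B (x n) b =
    character B s (val b) / D * expR (- (B (val b) w - B (val m) w)) ^+ n.
  rewrite /monomial_map /character /x -expRM_natl.
  have -> : D^-1 = expR (- ln D) by rewrite expRN lnK// posrE.
  rewrite -!expRD.
  congr expR; rewrite !linearDr !linearZr /= Ar divfK//; ring.
apply: (closed_cvg (closure (range (monomial_map B (A := A)))) (@closed_closure _ _)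
  (F := \oo) (u_ := fun n => monomial_map B (x n))).
  by apply: nearW => n; apply: subset_closure; exists (x n).
apply: ptws_cvg => b; have xb := funext (xE ^~ b).
suff : character B s (val b) / D * expR (- (B (val b) w - B (val m) w)) ^+ n
    @[n --> \oo] --> face_point B w s b by rewrite -xb.
have -> : face_point B w s b = character B s (val b) / D * (argmin B w b)%:R.
  by rewrite /face_point -/D -mulrA mulrC.
apply: cvgMl_tmp; have [wb|wb] := boolP (argmin B w b).
  have /eqP : B (val b - val m) w == 0 by rewrite argmin_edge.
  rewrite linearBl => ->; rewrite oppr0 expR0.
  by apply: cvg_near_cst; apply: nearW => n; rewrite expr1n.
apply: cvg_expr; rewrite ger0_norm ?expR_ge0// expR_lt1 oppr_lt0 subr_gt0.
rewrite ltNge; apply: contra wb => bm; apply/argminP => q.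
exact: le_trans bm (argminP _ _ _ wm q).
Qed.

Hypothesis B_nondeg : forall u, (forall v, B u v = 0) -> u = 0.

Lemma Z_varietyP z : Z_variety B A z <->
  simplex R A z /\ exists w s, z = face_point B w s.
Proof.
split=> [[zY zS]|[zS [w [s zE]]]].
  split=> //; have [z0 z1] := zS.
  exact: (@binomial_face_point _ _ _ B A B_nondeg z z0 z1 (Y_variety_binomial zY)).
split=> //; rewrite zE.
have [_ /sum1_neq0[a _]] := zS.
exact: face_point_Y_variety.
Qed.

Lemma Z_variety_compact : compact (Z_variety B A).
Proof.
apply: (@subclosed_compact _ _ [set z : {ptws A -> R} | forall a, `[0, 1]%classic (z a)]).
- rewrite /Z_variety /Y_variety.
  have nonneg_closed : closed (nonneg_tuples R A).
    rewrite (_ : nonneg_tuples R A =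
      \bigcap_(a in setT) proj a @^-1` [set y : R | 0 <= y]); last first.
      by apply/seteqP; split=> z /= z0 a => [_|]; exact: z0.
    apply: closed_bigI => a _; apply: preimage_closed; last exact: closed_ge.
    by move=> z _; exact: (@proj_continuous A (fun=> R) a z).
  have sum_cont : continuous (fun z : {ptws A -> R} => \sum_i z i).
    apply: continuous_big => [|a _ z]; first exact: add_continuous.
    exact: (@proj_continuous A (fun=> R) a z).
  apply: closedI; first by apply: closedI; [|exact: closed_closure].
  apply: closedI => //.
  apply: (@preimage_closed _ _ (fun z : {ptws A -> R} => \sum_i z i) [set y : R | y = 1]);
    last exact: closed_eq.
  by move=> z _; exact: sum_cont.
- by apply: (@tychonoff A (fun=> R) (fun=> `[0, 1]%classic)) => a; exact: segment_compact.
move=> z [_ [z0 z1]] a; rewrite /= in_itv /= z0 -z1 (bigD1 a)//= lerDl.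
exact: sumr_ge0.
Qed.

End ProjectiveVariety.

(** * Birch's theorem *)

Section FirstOrder.
Context {R : realType}.

(** From [1 - x <= expR (- x)] by taking inverses. *)
Lemma expR_le_quad (x : R) : x <= 2^-1 -> expR x <= 1 + x + 2 * x ^+ 2.
Proof.
move=> x2; have x1 : 0 < 1 - x by lra.
rewrite -(ler_pM2r x1); apply: (@le_trans _ _ 1).
  by rewrite -ler_pdivlMl ?expR_gt0// mulr1 -expRN expR_ge1Dx.
have -> : (1 + x + 2 * x ^+ 2) * (1 - x) = 1 + x ^+ 2 * (1 - 2 * x) by ring.
by rewrite lerDl mulr_ge0 ?sqr_ge0//; lra.
Qed.

Context {I : finType}.
Implicit Types z k : I -> R.

(** The function of [t] is minimal at 0, where its derivative is the mean of [k]. *)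
Lemma mean_expR_ge1 z k : (forall i, 0 <= z i) -> \sum_i z i = 1 ->
  (forall t, 1 <= \sum_i z i * expR (t * k i)) -> \sum_i z i * k i = 0.
Proof.
have half l : (forall i, 0 <= z i) -> \sum_i z i = 1 ->
    (forall t, 1 <= \sum_i z i * expR (t * l i)) -> 0 <= \sum_i z i * l i.
  move=> z0 z1 zl; set K := \sum_i _; rewrite leNgt; apply/negP => K0.
  pose Q := \sum_i z i * l i ^+ 2; pose S := \sum_i `|l i|.
  have Q0 : 0 <= Q by apply: sumr_ge0 => i _; rewrite mulr_ge0 ?sqr_ge0.
  have S0 : 0 <= S by exact: sumr_ge0.
  (* Small enough for [expR_le_quad], and for the linear term [t * K] to dominate
     the quadratic one. *)
  pose t := Num.min ((S + 1)^-1 / 2) (- K / (4 * (Q + 1))).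
  have t0 : 0 < t by rewrite lt_min !divr_gt0 ?invr_gt0 ?oppr_gt0//; lra.
  have tl i : t * l i <= 2^-1.
    apply: (@le_trans _ _ (t * (S + 1))).
      rewrite ler_pM2l// (le_trans (ler_norm _))// /S (bigD1 i)//= -addrA.
      by rewrite lerDl addr_ge0//; exact: sumr_ge0.
    by rewrite -ler_pdivlMr ?ltr_wpDl// mulrC ge_min lexx.
  have : 1 <= 1 + t * K + 2 * t ^+ 2 * Q.
    apply: le_trans (zl t) _.
    have -> : 1 + t * K + 2 * t ^+ 2 * Q =
        \sum_i z i * (1 + t * l i + 2 * (t * l i) ^+ 2).
      transitivity (\sum_i z i + t * K + 2 * t ^+ 2 * Q); first by rewrite z1.
      by rewrite /K /Q !mulr_sumr -!big_split /=; apply: eq_bigr => i _; ring.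
    by apply: ler_sum => i _; rewrite ler_wpM2l// expR_le_quad.
  have tQ : t * (4 * (Q + 1)) <= - K by rewrite -ler_pdivlMr ?ge_min ?lexx ?orbT//; lra.
  have : t * (K + 2 * t * Q) < 0 by rewrite pmulr_rlt0//; nra.
  lra.
move=> z0 z1 zk; apply/le_anti; rewrite half// andbT -oppr_ge0 -sumrN.
under eq_bigr do rewrite -mulrN.
apply: half => // t; have := zk (- t); congr (_ <= _).
by apply: eq_bigr => i _; rewrite mulNr mulrN.
Qed.

End FirstOrder.

Section Birch.
Context {R : realType} {M N : vectType R}.
Context (B : {bilinear M -> N -> R | *%R & *%R}) (A : {fset M}).
Implicit Types (v w s : N) (a b q : A) (c : A -> R).

Lemma moment_mapB (z : {ptws A -> R}) v :
  B (moment_map A z) v = \sum_a z a * B (val a) v.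
Proof. by rewrite linear_sumlz; apply: eq_bigr => a _; rewrite linearZl. Qed.

(** The moment of a face point lies on the face exposed by [w], so every point of
    [A] that contributes to it does too. *)
Lemma face_point_support w s (z z' : {ptws A -> R}) :
  z = face_point B w s -> simplex R A z -> simplex R A z' ->
  moment_map A z' = moment_map A z -> forall a, z' a != 0 -> z a != 0.
Proof.
move=> zE [z0 z1] [z'0 z'1] zz' a z'a; rewrite zE face_point_neq0.
have [m wm] := argmin_exists B w a.
have ge0 (b : A) : 0 <= z' b * (B (val b) w - B (val m) w).
  by rewrite mulr_ge0 ?z'0// subr_ge0 (argminP _ _ _ wm).
have sum0 : \sum_b z' b * (B (val b) w - B (val m) w) = 0.
  under eq_bigr do rewrite mulrBr.
  rewrite sumrB -mulr_suml z'1 mul1r -moment_mapB zz' moment_mapB.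
  rewrite (eq_bigr (fun b => z b * B (val m) w)) => [|b _].
    by rewrite -mulr_suml z1 mul1r subrr.
  have [->|zb] := eqVneq (z b) 0; first by rewrite !mul0r.
  congr (_ * _); apply/le_anti; rewrite (argminP _ _ _ wm) andbT.
  by move: zb; rewrite zE face_point_neq0 => /argminP ->.
have /eqP := psumr_eq0P (fun b _ => ge0 b) sum0 (i := a) erefl.
rewrite mulf_eq0 (negbTE z'a) subr_eq0 => /eqP am.
by apply/argminP => b; rewrite am (argminP _ _ _ wm).
Qed.

(** The supports agree by [face_point_support].  There [ln z - ln z'] is an affine
    function of [a], so it is orthogonal to [z - z'], which has total weight and
    moment zero.  As the logarithm is increasing, [z = z']. *)
Lemma moment_map_inj w s w' s' (z z' : {ptws A -> R}) :
  z = face_point B w s -> z' = face_point B w' s' ->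
  simplex R A z -> simplex R A z' ->
  moment_map A z = moment_map A z' -> z = z'.
Proof.
move=> zE z'E zS z'S zz'; have [z0 z1] := zS; have [z'0 z'1] := z'S.
have supp a : (z a == 0) = (z' a == 0).
  apply: negb_inj; apply/idP/idP.
    exact: (face_point_support z'E).
  exact: (face_point_support zE).
have zp a : z a != 0 -> z a \is Num.pos by move=> za; rewrite posrE lt_def za z0.
have z'p a : z a != 0 -> z' a \is Num.pos.
  by rewrite supp => za; rewrite posrE lt_def za z'0.
have [k lnE] : exists k, forall a, z a != 0 ->
    ln (z a) - ln (z' a) = k - B (val a) (s - s').
  have lnf w1 s1 a : argmin B w1 a -> ln (face_point B w1 s1 a) = - B (val a) s1 -
     ln (\sum_(b : A) (argmin B w1 b)%:R * character B s1 (val b)).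
    move=> wa; rewrite /face_point wa mul1r ln_div ?posrE ?expR_gt0 ?expRK//.
    exact: face_point_denom_gt0.
  exists (ln (\sum_(b : A) (argmin B w' b)%:R * character B s' (val b)) -
          ln (\sum_(b : A) (argmin B w b)%:R * character B s (val b))) => a za.
  rewrite zE z'E !lnf; last 2 first.
  - by rewrite -(face_point_neq0 B w' s') -z'E -supp.
  - by rewrite -(face_point_neq0 B w s) -zE.
  by rewrite linearBr /=; ring.
have term_ge0 a : 0 <= (z a - z' a) * (ln (z a) - ln (z' a)).
  have [za|za] := eqVneq (z a) 0.
    by move: (supp a); rewrite za eqxx => /esym/eqP ->; rewrite !subrr mul0r.
  have [zz|/ltW zz] := leP (z' a) (z a).
    by rewrite mulr_ge0 ?subr_ge0// ler_ln ?zp ?z'p.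
  by rewrite mulr_le0 ?subr_le0// ler_ln ?zp ?z'p.
have sum0 : \sum_a (z a - z' a) * (ln (z a) - ln (z' a)) = 0.
  rewrite (eq_bigr (fun a =>
    (z a - z' a) * k - (z a - z' a) * B (val a) (s - s'))); last first.
    move=> a _; have [za|za] := eqVneq (z a) 0; last by rewrite lnE// mulrBr.
    by move: (supp a); rewrite za eqxx => /esym/eqP ->; rewrite !subrr !mul0r subrr.
  rewrite sumrB -mulr_suml sumrB z1 z'1 subrr mul0r sub0r; apply/eqP.
  under eq_bigr do rewrite mulrBl.
  by rewrite oppr_eq0 sumrB -!moment_mapB zz' subrr.
apply/funext => a; have [za|za] := eqVneq (z a) 0.
  by move: (supp a); rewrite za eqxx => /esym/eqP ->.
have /eqP := psumr_eq0P (fun b _ => term_ge0 b) sum0 (i := a) erefl.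
rewrite mulf_eq0 !subr_eq0 => /orP[/eqP//|/eqP]; apply: ln_inj; [exact: zp|exact: z'p].
Qed.

Hypothesis A_hyperplane : exists v0 r, r != 0 /\ forall a, B (val a) v0 = r.
Hypothesis B_nondeg : forall u, (forall v, B u v = 0) -> u = 0.

(** The effect of a one-parameter subgroup of the torus. *)
Lemma face_point_shift w s u t a :
  let e b := expR (- t * B (val b) u) in
  let E := \sum_(b : A) face_point B w s b * e b in
  0 < E /\ face_point B w (s + t *: u) a = face_point B w s a * e a / E.
Proof.
move=> e E; have D0 := face_point_denom_gt0 B w s a.
have [f0 _] := face_point_simplex B w s a.
have E0 : 0 < E.
  have [m wm] := argmin_exists B w a.
  have e_ge0 b : 0 <= face_point B w s b * e b by rewrite mulr_ge0// expR_ge0.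
  rewrite lt_def sumr_ge0// andbT psumr_neq0//.
  apply/hasP; exists m; rewrite ?mem_index_enum//= mulr_gt0 ?expR_gt0//.
  by rewrite lt_def face_point_neq0 wm f0.
split=> //; set D := \sum_b _ in D0.
pose z b := face_point B w s b * e b / E.
suff <- : z = face_point B w (s + t *: u) by [].
apply: (face_point_eq (k := (D * E)^-1)) => [|b].
  by rewrite -mulr_suml mulfV// gt_eqF.
have -> : character B (s + t *: u) (val b) = character B s (val b) * e b.
  by rewrite /character linearDr linearZr /= opprD expRD /e mulNr.
by rewrite /z /face_point -/D; field; rewrite !gt_eqF.
Qed.

(** Write [p] with convex coefficients [q] and let [z] maximize the monomial with
    exponents [q] on the compact variety.  The maximum is positive, so [z] does not
    vanish where [q] does not.  Maximality under the one-parameter subgroups of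
    the torus is the first-order condition of [mean_expR_ge1], saying that [p] and
    the moment of [z] have the same pairing with each [u]. *)
Lemma moment_map_surj (p : M) : convex_hull [set` A] p ->
  exists2 z, Z_variety B A z & moment_map A z = p.
Proof.
case/convex_hull_fsetP => q [q0 q1 pE].
have [a0 _] := sum1_neq0 q1.
have ZP := Z_varietyP A_hyperplane B_nondeg.
have face_Z w s : Z_variety B A (face_point B w s).
  by apply/ZP; split; [exact: face_point_simplex|exists w, s].
have cont : continuous (fun z : {ptws A -> R} => monomial z q).
  move=> z; apply: (@cvg_monomial _ _ _ (nbhs z) (nbhs_filter z) id) => a; last by left.
  exact: (@proj_continuous A (fun=> R) a z).
have [//|z /set_mem Zz zmax] := @compact_EVT_max _ _ _ (Z_variety B A)
  _ (@Z_variety_compact _ _ _ B A) (continuous_subspaceT cont).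
  by exists (face_point B 0 0); exact: face_Z.
exists z => //.
have [zS [w [s zE]]] := (iffLR (ZP z)) Zz; have [z0 z1] := zS.
have zq a : z a = 0 -> q a = 0.
  move=> za; apply/eqP; apply: contraT => qa.
  have := zmax _ (mem_set (face_Z 0 0)).
  rewrite {2}/monomial (bigD1 a)//= za normr0 powR0// mul0r leNgt.
  rewrite prodr_gt0// => b _; rewrite powR_gt0// normr_gt0 face_point_neq0.
  by apply/argminP => b'; rewrite !linear0r.
apply/eqP; rewrite -subr_eq0; apply/eqP/B_nondeg => u.
rewrite linearBl moment_mapB.
have -> : B p u = \sum_a z a * B p u by rewrite -mulr_suml z1 mul1r.
rewrite -sumrB; under eq_bigr do rewrite -mulrBr.
apply: mean_expR_ge1 => // t.
have [] := face_point_shift w s u (- t) a0; rewrite -zE.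
set E := \sum_b _ => E0 _.
have shiftE : face_point B w (s + - t *: u) =
    fun b => E^-1 * (z b * expR (t * B (val b) u)).
  apply/funext => b; have [_ ->] := face_point_shift w s u (- t) b.
  by rewrite -zE -/E opprK mulrC.
have := zmax _ (mem_set (face_Z w (s + - t *: u))).
rewrite shiftE monomial_scale ?invr_eq0 ?gt_eqF// q1 monomialM monomial_expR.
have -> : \sum_b q b * (t * B (val b) u) = t * B p u.
  rewrite pE linear_sumlz mulr_sumr; apply: eq_bigr => b _.
  by rewrite linearZl /=; ring.
have mz0 : 0 < monomial z q.
  by rewrite (monomialE z0)// expR_gt0.
rewrite powRr1// gtr0_norm ?invr_gt0// mulrCA -ler_pdivlMl// mulVf ?gt_eqF//.
rewrite ler_pdivrMl// mulr1 => pE'.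
have -> : \sum_i z i * expR (t * (B (val i) u - B p u)) = E * expR (- (t * B p u)).
  rewrite mulr_suml; apply: eq_bigr => b _.
  by rewrite opprK -mulrA -expRD mulrBr.
by rewrite expRN ler_pdivlMr ?expR_gt0// mul1r.
Qed.

End Birch.

(** * Gluing the charts *)

Section ArgminFaces.
Context {R : realType} {M N : vectType R}.
Context (B : {bilinear M -> N -> R | *%R & *%R}) (A : {fset M}).
Implicit Types (v w s : N) (a b q : A) (c : A -> R) (phi : M -> R).

Lemma argmin_cone_sub v w : argmin_cone B A v w ->
  argmin_cone B A w `<=` argmin_cone B A v.
Proof. by move=> vw z wz a /vw/wz. Qed.

(** The face is cut out by the sum of the edge vectors leading to minimizers of [w]. *)
Lemma argmin_cone_face v w a : argmin B v a -> argmin_cone B A v w ->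
  is_face B (argmin_cone B A w) (argmin_cone B A v).
Proof.
move=> va vw; have edge_ge0 b z : argmin_cone B A v z -> 0 <= B (val b - val a) z.
  by move=> vz; exact: (dual_argmin_cone_edge b va).
exists (\sum_(b : A | argmin B w b) (val b - val a)).
  by move=> z vz; rewrite linear_sumlz; apply: sumr_ge0 => b _; exact: edge_ge0.
apply/seteqP; split=> [z wz|z [vz /= zu] b wb].
  split; first exact: argmin_cone_sub vw _ wz.
  rewrite /= linear_sumlz big1// => b /wz zb; have za := wz _ (vw _ va).
  by apply/eqP; rewrite argmin_edge.
rewrite linear_sumlz in zu.
have /eqP := psumr_eq0P (fun b _ => edge_ge0 b z vz) zu wb.
by rewrite argmin_edge//; exact: vz.
Qed.

Lemma orbit_point_restrict v w s u : argmin_cone B A v w ->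
  dual_cone B (argmin_cone B A v) u ->
  orbit_point B (argmin_cone B A w) w s u = orbit_point B (argmin_cone B A v) w s u.
Proof.
move=> vw vu; rewrite /orbit_point; congr (if _ then _ else _).
have wu : dual_cone B (argmin_cone B A w) u.
  by move=> z wz; apply: vu; exact: argmin_cone_sub wz.
by apply/asboolP/asboolP => -[].
Qed.

Hypothesis B_nondeg : forall u, (forall v, B u v = 0) -> u = 0.

(** Coordinates in the chart of [v] do not vanish on the face exposed by [v], so this
    face lies in the support; then [phi] and the orbit point have the same
    coordinates. *)
Lemma chart_of_face_point v a phi w s : argmin B v a ->
  hom_c B (dual_cone B (argmin_cone B A v)) phi ->
  simplex_coords phi a = face_point B w s ->
  argmin_cone B A v w /\ phi = orbit_point B (argmin_cone B A v) w s.
Proof.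
move=> va phiC E; have vw : argmin_cone B A v w.
  move=> b vb; rewrite -(face_point_neq0 B w s) -E gt_eqF//.
  exact: simplex_coords_gt0 phiC _ _ va vb.
split=> //; apply: (chart_eq B_nondeg va phiC).
  exact: orbit_point_hom_c.
by rewrite simplex_coords_orbit.
Qed.

End ArgminFaces.

Section Gluing.
Context {R : realType} {M N : vectType R}.
Context (B : {bilinear M -> N -> R | *%R & *%R}) (A : {fset M}).
Hypothesis B_nondeg : forall u, (forall v, B u v = 0) -> u = 0.
Hypothesis A_hyperplane : exists v0 r, r != 0 /\ forall a : A, B (val a) v0 = r.
Implicit Types (v w s : N) (a b q : A).

Let Sigma := normal_fan B (convex_hull [set` A]).
Implicit Types x y : charts B Sigma.

Lemma fan_vertex (sigma : Sigma) :
  exists a : A, forall w, val sigma w -> argmin B w a.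
Proof.
have /normal_fanP[v [a [va ->]]] := set_valP sigma.
by exists a => w; apply.
Qed.

(** A base point for the coordinates on each chart; by [simplex_coords_base] the
    choice is irrelevant. *)
Definition vertex (sigma : Sigma) : A := sval (cid (fan_vertex sigma)).

Definition chart_coords x : A -> R := simplex_coords (set_val (tagged x)) (vertex (tag x)).

Lemma chartP x : exists v, [/\ val (tag x) = argmin_cone B A v,
  argmin B v (vertex (tag x)) &
  hom_c B (dual_cone B (argmin_cone B A v)) (set_val (tagged x))].
Proof.
have /normal_fanP[v [a [va E]]] := set_valP (tag x); exists v; split=> //.
  by apply: (svalP (cid (fan_vertex (tag x)))); rewrite E.
by rewrite -E; exact: set_valP (tagged x).
Qed.

Lemma chart_coords_simplex x : simplex R A (chart_coords x).
Proof. by have [v [_ vx phiC]] := chartP x; exact: simplex_coordsP phiC _ vx. Qed.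

(** A base point for the larger cone is also one for its face, and the coordinates
    only involve values on the smaller dual cone. *)
Lemma glued_chart_coords x y : glued x y -> chart_coords x = chart_coords y.
Proof.
have [v [Ex vx phiC]] := chartP x; have [w [Ey wy psiC]] := chartP y.
case=> -[u _ faceE] agree; rewrite Ex Ey in faceE.
have vy : argmin B v (vertex (tag y)).
  have : argmin_cone B A v v by [].
  by rewrite faceE => -[/(_ _ wy)].
rewrite /chart_coords (simplex_coords_base phiC vx vy).
have E b : set_val (tagged x) (val b - val (vertex (tag y))) =
    set_val (tagged y) (val b - val (vertex (tag y))).
  by apply: agree; rewrite Ey; exact: dual_argmin_cone_edge.
apply/funext => b; rewrite /simplex_coords E; congr (_ / _).
by apply: eq_bigr => q _; exact: E.
Qed.

Lemma glue_chart_coords x y : glue_rel x y -> chart_coords x = chart_coords y.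
Proof.
move=> /asboolP; elim=> {x y} [x y|//|x y _ ->//|x y z _ -> _ ->//].
exact: glued_chart_coords.
Qed.

Lemma chart_coords_face_point x : exists w s, chart_coords x = face_point B w s.
Proof.
have [v [_ vx phiC]] := chartP x.
have [z0 z1] := chart_coords_simplex x.
apply: (binomial_face_point B_nondeg z0 z1).
exact: (simplex_coords_binomial B_nondeg phiC A_hyperplane vx).
Qed.

Lemma argmin_cone_fan w a : argmin B w a -> Sigma (argmin_cone B A w).
Proof. by move=> wa; apply/normal_fanP; exists w, a. Qed.

Lemma exists_chart v w s a : argmin B v a -> argmin_cone B A v w ->
  exists x, val (tag x) = argmin_cone B A v /\
            set_val (tagged x) = orbit_point B (argmin_cone B A v) w s.
Proof.
move=> va vw.
by exists (existT (fun sigma : Sigma => chart B (val sigma))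
  (SigSub (mem_set (argmin_cone_fan va))) (SigSub (mem_set (orbit_point_hom_c B s vw)))).
Qed.

Lemma orbit_chart_coords x v w s :
  val (tag x) = argmin_cone B A v -> argmin_cone B A v w ->
  set_val (tagged x) = orbit_point B (argmin_cone B A v) w s ->
  chart_coords x = face_point B w s.
Proof.
move=> Ex vw xE; have [v' [Ex' vx _]] := chartP x.
rewrite /chart_coords xE simplex_coords_orbit//.
have : argmin_cone B A v' v by rewrite -Ex' Ex.
exact.
Qed.

Lemma chart_coords_surj z : Z_variety B A z -> exists x, chart_coords x = z.
Proof.
move=> /(Z_varietyP A_hyperplane B_nondeg)[[_ z1] [w [s zE]]].
have [a _] := sum1_neq0 z1.
have [m wm] := argmin_exists B w a.
have ww : argmin_cone B A w w by [].
have [x [Ex xE]] := exists_chart s wm ww.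
by exists x; rewrite (orbit_chart_coords Ex ww xE) zE.
Qed.

(** Both points are restrictions of the orbit point [t] in the chart of the normal
    cone of the common support, which is a face of both cones. *)
Lemma chart_coords_glue x y : chart_coords x = chart_coords y -> glue_rel x y.
Proof.
have [w [s xE]] := chart_coords_face_point x.
rewrite xE => yE.
have face_glued t : face_point B w s = chart_coords t ->
    argmin B w (vertex (tag t)) /\
    forall x, val (tag x) = argmin_cone B A w ->
      set_val (tagged x) = orbit_point B (argmin_cone B A w) w s -> glued x t.
  move=> tE; have [v [Et vt phiC]] := chartP t.
  have [vw phiE] := chart_of_face_point B_nondeg vt phiC (esym tE).
  split=> [|u Eu uE]; first exact: vw.
  split; first by rewrite Et Eu; exact: argmin_cone_face vt vw.
  by move=> q tq; rewrite Et in tq; rewrite uE phiE; exact: orbit_point_restrict.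
have [wx glx] := face_glued x (esym xE); have [_ gly] := face_glued y yE.
have ww : argmin_cone B A w w by [].
have [t [Et tE]] := exists_chart s wx ww.
apply/asboolP/(rst_trans _ _ _ t); last exact/rst_step/gly.
exact/rst_sym/rst_step/glx.
Qed.

End Gluing.

(** * Topology and the main theorem *)

Lemma initial_cvg {S : choiceType} {T : topologicalType} (w : S -> T) {X : Type}
    (F : set_system X) {FF : Filter F} (f : X -> initial_topology w)
    (l : initial_topology w) :
  w (f x) @[x --> F] --> w l -> f x @[x --> F] --> l.
Proof.
move=> fl U [? /= [[W oW <-]]] /= Wl /filterS; apply.
by apply: fl; exact: open_nbhs_nbhs.
Qed.

Lemma euclidean_hausdorff {R : realType} (V : vectType R) :
  hausdorff_space (euclidean V).
Proof.
move=> p q pq; pose r := passmx.rVof (vbasis {:V}).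
suff : r p = r q.
  have eb := vbasisP {:V}.
  by move/(congr1 (passmx.vecof (vbasis {:V}))); rewrite !passmx.rVofK.
apply: norm_hausdorff => U W.
move=> /(@initial_continuous _ _ r p) pU /(@initial_continuous _ _ r q) qW.
by have [x [Ux Wx]] := pq _ _ pU qW; exists (r x).
Qed.

(** If [r] failed to be continuous at [t], compactness would provide a cluster point
    of its values near [t] away from [r t]; by continuity of [h] and [k] it has the
    same image as [r t], against injectivity. *)
Lemma compact_lift_continuous {T X Y : topologicalType} (K : set X) (h : X -> Y)
    (r : T -> X) (k : T -> Y) :
  hausdorff_space Y -> compact K -> continuous h -> continuous k ->
  (forall t, K (r t)) -> (forall t, h (r t) = k t) ->
  (forall x x', K x -> K x' -> h x = h x' -> x = x') -> continuous r.
Proof.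
move=> hY cK hc kc rK hr hinj t U Ut; apply: contrapT => nU.
wlog oU : U Ut nU / open U.
  move=> wl; apply: (wl U^°); [exact: nbhs_interior| |exact: open_interior].
  by apply: contra_not nU => /filterS; apply => x; exact: interior_subset.
pose F := within (~` (r @^-1` U)) (nbhs t).
have FF : ProperFilter F.
  apply: Build_ProperFilter_ex => S FS; apply: contrapT => nS; apply: nU.
  rewrite /= nbhs_filterE.
  move: FS; rewrite /F /within /= near_simpl; apply: filterS => x xS.
  by apply: contrapT => xU; apply: nS; exists x; apply: xS.
have [x [[Kx Ux] Fx]] : ((K `&` ~` U) `&` cluster (r @ F)) !=set0.
  apply: (compact_closedI cK (open_closedC oU)); rewrite /= nbhs_filterE.
  by apply: filterS (withinT _ _) => s Us; split.
suff xt : x = r t by apply: Ux; rewrite xt; exact: nbhs_singleton.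
apply: hinj => //; rewrite hr; apply/esym/hY => V W kV hW.
have [||y [Vy Wy]] := Fx (h @^-1` V) (h @^-1` W); last by exists (h y).
  have kt : nbhs t (k @^-1` V) by exact: kc kV.
  rewrite /= nbhs_filterE /F /within /=; apply: filterS kt => s Vs _.
  by rewrite /preimage /= hr.
exact: hc hW.
Qed.

Lemma moment_map_continuous {R : realType} {M : vectType R} (A : {fset M}) :
  continuous (moment_map A : {ptws A -> R} -> euclidean M).
Proof.
apply: continuous_comp_initial => z.
pose r := passmx.rVof (vbasis {:M}).
have rD : linear r := passmx.rVof_linear _.
have rE : r \o moment_map A = fun z : {ptws A -> R} => \sum_a z a *: r (val a).
  apply/funext => y; rewrite /comp /moment_map.
  elim/big_rec2: _ => [|a x u _ xu]; last by rewrite rD -xu.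
  by apply/rowP => i; rewrite !mxE linear0.
rewrite rE; apply: continuous_big => [|a _ y]; first exact: add_continuous.
exact: (@cvgZr_tmp R 'rV[R]_(\dim {:M}) _ (nbhs y) (nbhs_filter y) (fun z => z a) _ _
  (@proj_continuous A (fun=> R) a y)).
Qed.

Section ToricMap.
Context {R : realType} {M N : vectType R}.
Context (B : {bilinear M -> N -> R | *%R & *%R}) (A : {fset M}).
Hypothesis B_nondeg : forall u, (forall v, B u v = 0) -> u = 0.
Hypothesis A_hyperplane : exists v0 r, r != 0 /\ forall a : A, B (val a) v0 = r.
Implicit Types (v w s : N) (a b q : A).

Let P := convex_hull [set` A].
Let Sigma := normal_fan B P.

Local Open Scope quotient_scope.

Definition toric_coords (y : toric_variety B Sigma) : simplex R A :=
  SigSub (mem_set (chart_coords_simplex (repr y))).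

Lemma toric_coords_pi (x : charts B Sigma) :
  set_val (toric_coords (\pi_(toric_variety B Sigma) x)) = chart_coords x.
Proof.
apply: glue_chart_coords.
by have /eqmodP : \pi_(toric_variety B Sigma) (repr (\pi_(toric_variety B Sigma) x)) =
  \pi_(toric_variety B Sigma) x by exact: reprK.
Qed.

Lemma toric_coords_inj : injective toric_coords.
Proof.
move=> x y xy; rewrite -[x]reprK -[y]reprK; apply/eqmodP.
apply: (chart_coords_glue B_nondeg A_hyperplane).
by rewrite -!toric_coords_pi !reprK xy.
Qed.

Lemma toric_coords_range :
  range (fun y => set_val (toric_coords y)) = Z_variety B A.
Proof.
apply/seteqP; split=> [_ [y _ <-]|z Zz].
  apply/(Z_varietyP A_hyperplane B_nondeg); split; first exact: set_valP (toric_coords y).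
  exact: (chart_coords_face_point B_nondeg A_hyperplane (repr y)).
have [x <-] := chart_coords_surj B_nondeg A_hyperplane Zz.
by exists (\pi_(toric_variety B Sigma) x); rewrite ?toric_coords_pi.
Qed.

Lemma chart_eval_continuous (sigma : set N) (u : M) :
  continuous ((fun phi => set_val phi u) : chart B sigma -> R).
Proof.
move=> phi; have sv : set_val x @[x --> phi] --> (set_val phi : {ptws M -> R}).
  exact: initial_continuous.
exact: (@ptws_eval_cvg M R _ (nbhs phi) (nbhs_filter phi) set_val _ u sv).
Qed.

Lemma chart_coords_continuous :
  continuous ((fun x => chart_coords x) : charts B Sigma -> {ptws A -> R}).
Proof.
pose f (sigma : Sigma) (phi : chart B (val sigma)) : {ptws A -> R} :=
  simplex_coords (set_val phi) (vertex sigma).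
suff f_cont : forall sigma, continuous (f sigma).
  suff : continuous (fun x : charts B Sigma => f (projT1 x) (projT2 x)) by [].
  exact: sigT_continuous.
move=> sigma phi.
apply: (@ptws_cvg _ _ _ (nbhs phi) (nbhs_filter phi)) => a.
have [v [_ va phiC]] :=
  chartP (existT (fun sigma : Sigma => chart B (val sigma)) sigma phi).
apply: (@cvgM _ _ (nbhs phi) (nbhs_filter phi)); first exact: chart_eval_continuous.
apply: (@cvgV _ _ (nbhs phi) (nbhs_filter phi)).
  exact/lt0r_neq0/(chart_denom_gt0 phiC va).
apply: cvg_big => [|b _]; first exact: add_continuous.
exact: chart_eval_continuous.
Qed.

Lemma toric_coords_continuous : continuous toric_coords.
Proof.
apply/quotient_continuous; apply: continuous_comp_initial.
rewrite (_ : _ \o _ = fun x : charts B Sigma => chart_coords x); last first.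
  by apply/funext => x; exact: toric_coords_pi.
exact: chart_coords_continuous.
Qed.

Definition torus_hom (v : euclidean N) : torus R A :=
  SigSub (mem_set ((fun a => expR_gt0 _) : pos_tuples R A (monomial_map B v))).

Lemma torus_hom_continuous : continuous torus_hom.
Proof.
apply: continuous_comp_initial => v.
apply: (@ptws_cvg _ _ _ (nbhs v) (nbhs_filter v)) => a.
have lB : linear_for *%R (B (val a)) by move=> c x y; rewrite linearPr.
apply: (@cvg_comp _ _ _ (fun w : euclidean N => - B (val a) w) expR _
  (nbhs (- B (val a) v))).
  by apply: continuousN; exact: linear_euclidean_continuous.
exact: continuous_expR.
Qed.

Lemma torus_homM v w : torus_hom (mul_TN v w) = mul_torus (torus_hom v) (torus_hom w).
Proof.
apply: val_inj; apply/funext => a /=.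
by rewrite /monomial_map /character /mul_TN linearDr opprD expRD.
Qed.

Lemma simplex_coords_translate (phi : M -> R) v a b :
  \sum_(q : A) phi (val q - val a) != 0 ->
  simplex_coords (fun u => character B v u * phi u) a b =
  character B v (val b) * simplex_coords phi a b /
    \sum_(q : A) character B v (val q) * simplex_coords phi a q.
Proof.
rewrite /simplex_coords; set D := \sum_(q : A) phi _ => D0.
set k := character B v (- val a); have k0 : k != 0 by rewrite gt_eqF ?expR_gt0.
have kE (q : A) : character B v (val q - val a) = k * character B v (val q).
  by rewrite characterD mulrC.
under [in LHS]eq_bigr do rewrite kE -mulrA.
under [in RHS]eq_bigr do rewrite mulrA.
rewrite -mulr_sumr -mulr_suml kE; set S := \sum_q _.
have [->|S0] := eqVneq S 0; first by rewrite mulr0 mul0r !invr0 !mulr0.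
by field; rewrite k0 D0 S0.
Qed.

Lemma toric_coords_act v y :
  toric_coords (act_toric v y) = act_simplex (torus_hom v) (toric_coords y).
Proof.
apply: val_inj; rewrite -!set_valE -[y in LHS]reprK act_toric_pi toric_coords_pi.
apply/funext => b /=; have [w [_ wa phiC]] := chartP (repr y).
have /lt0r_neq0 D0 := chart_denom_gt0 phiC wa.
exact: (simplex_coords_translate _ _ D0).
Qed.

Lemma moment_map_toric_inj y y' :
  moment_map A (set_val (toric_coords y)) = moment_map A (set_val (toric_coords y')) ->
  y = y'.
Proof.
have [w [s yE]] := chart_coords_face_point B_nondeg A_hyperplane (repr y).
have [w' [s' y'E]] := chart_coords_face_point B_nondeg A_hyperplane (repr y').
move=> yy'; apply/toric_coords_inj/val_inj.
exact: (moment_map_inj yE y'E (set_valP (toric_coords y)) (set_valP (toric_coords y'))).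
Qed.

Lemma moment_map_toric_mem y : P (moment_map A (set_val (toric_coords y))).
Proof.
have [z0 z1] := set_valP (toric_coords y).
by apply/convex_hull_fsetP; exists (set_val (toric_coords y)).
Qed.

(** Continuity of the inverse of [toric_coords], for a lift [g] of a convergent
    family of coordinates.  Near [t0] the support contains that of the limit, the
    face exposed by [w], so [g t] lies in the chart of the normal cone of this
    face, where [chart_monomial] recovers it from its coordinates by monomials
    that are continuous at the limit. *)
Lemma toric_coords_local_inverse (T : topologicalType)
    (g : T -> toric_variety B Sigma) t0 :
  (fun t => set_val (toric_coords (g t)) : {ptws A -> R}) t @[t --> t0] -->
    (set_val (toric_coords (g t0)) : {ptws A -> R}) ->
  g t @[t --> t0] --> g t0.
Proof.
pose z t : {ptws A -> R} := set_val (toric_coords (g t)).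
rewrite -/(z t0) => zt.
have coord_cvg a : z t a @[t --> t0] --> z t0 a.
  exact: (@ptws_eval_cvg _ _ _ (nbhs t0) (nbhs_filter t0)).
have [w [s zE]] : exists w s, z t0 = face_point B w s.
  exact: chart_coords_face_point.
have [m wm] := argmin_exists B w (vertex (tag (repr (g t0)))).
pose rho : Sigma := SigSub (mem_set (argmin_cone_fan wm)).
have ww : argmin_cone B A w w by [].
have wa : argmin B w (vertex rho) by exact: (svalP (cid (fan_vertex rho)) w ww).
set a0 := vertex rho in wa.
pose chart_pt (phi : chart B (val rho)) : charts B Sigma :=
  existT (fun sigma : Sigma => chart B (val sigma)) rho phi.
pose near_face t := forall a, argmin B w a -> z t a != 0.
have [|h hP] := @choice T (chart B (val rho))
    (fun t phi => near_face t -> chart_coords (chart_pt phi) = z t).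
  move=> t; have [tw|ntw] := pselect (near_face t); last first.
    by exists (SigSub (mem_set (orbit_point_hom_c B s ww))).
  have [w' [s' tE]] : exists w s, z t = face_point B w s.
    exact: chart_coords_face_point.
  have ww' : argmin_cone B A w w'.
    by move=> a /tw; rewrite tE face_point_neq0.
  exists (SigSub (mem_set (orbit_point_hom_c B s' ww'))) => _; rewrite tE.
  exact: (orbit_chart_coords (v := w) _ ww').
have near_t0 : \forall t \near t0, near_face t.
  apply: (@filter_forall _ _ (fun a t => argmin B w a -> z t a != 0) (nbhs t0)) => a.
  have [wb|wb] := boolP (argmin B w a); last exact: nearW.
  have z0a : z t0 a != 0 by rewrite zE face_point_neq0.
  have := @cvgr_neq0 _ _ _ (nbhs t0) (nbhs_filter t0) _ _ (coord_cvg a) z0a.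
  by apply: filterS => t ta _.
have gE t : near_face t -> \pi_(toric_variety B Sigma) (chart_pt (h t)) = g t.
  move=> tw; apply/toric_coords_inj/val_inj.
  by rewrite -!set_valE toric_coords_pi hP.
have near_g : \forall t \near t0, \pi_(toric_variety B Sigma) (chart_pt (h t)) = g t.
  by apply: filterS near_t0.
rewrite -(nbhs_singleton near_g).
apply: cvg_trans (near_eq_cvg near_g) _.
apply: (@cvg_comp _ _ _ (chart_pt \o h) \pi_(toric_variety B Sigma) _
  (nbhs (chart_pt (h t0)))); last exact: pi_continuous.
apply: (@cvg_comp _ _ _ h chart_pt _ (nbhs (h t0))); last exact: existT_continuous.
apply: initial_cvg; apply: (@ptws_cvg _ _ _ (nbhs t0) (nbhs_filter t0)) => u.
have hC t : hom_c B (dual_cone B (argmin_cone B A w)) (set_val (h t)) := set_valP (h t).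
have [uC|uC] := pselect (dual_cone B (argmin_cone B A w) u); last first.
  have h0 t : set_val (h t) u = 0 by have [h0 _ _ _ _] := hC t; exact: h0.
  by apply: cvg_near_cst; apply: nearW => t; rewrite !h0.
have [c [c0 uE]] := (iffLR (dual_argmin_coneP B_nondeg u wa)) uC.
have hE t : near_face t -> monomial (fun b => z t b / z t a0) c = set_val (h t) u.
  move=> tw; rewrite uE (chart_monomial B_nondeg (hC t) wa c0).
  by have <- := hP t tw.
rewrite -(hE _ (nbhs_singleton near_t0)).
apply: (@cvg_trans _ (monomial (fun b => z t b / z t a0) c @[t --> t0])).
  by apply: near_eq_cvg; apply: filterS near_t0 => t; exact: hE.
have z0_neq0 a : argmin B w a -> z t0 a != 0.
  by rewrite zE face_point_neq0.
apply: (@cvg_monomial _ _ _ (nbhs t0) (nbhs_filter t0)) => b.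
  apply: (@cvgM _ _ (nbhs t0) (nbhs_filter t0)); first exact: coord_cvg.
  by apply: (@cvgV _ _ (nbhs t0) (nbhs_filter t0)); [exact: z0_neq0|exact: coord_cvg].
have [wb|wb] := boolP (argmin B w b); last by left; exact: c0.
by right; rewrite mulf_neq0 ?invr_eq0 ?z0_neq0.
Qed.

End ToricMap.

Theorem theorem4p7 (R : realType) (M N : vectType R)
  (B : {bilinear M -> N -> R | *%R & *%R}) (hB : perfect_pairing B)
  (P : set M) (hP : is_polytope P)
  (hP_hyperplane : exists (v : N) (r : R),
     r != 0 /\ forall p, P p -> B p v = r)
  (A : {fset M}) (hAP : [set` A] `<=` P) (hA : convex_hull [set` A] = P) :
  exists (psi : toric_variety B (normal_fan B P) -> simplex R A)
         (Psi : euclidean N -> torus R A),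
    [/\ is_toric_map (@mul_TN R N) (@mul_torus R A)
          (@act_toric R M N B (normal_fan B P)) (@act_simplex R A) psi Psi,
        injective psi,
        range (fun y => set_val (psi y)) = Z_variety B A
      & exists f : toric_variety B (normal_fan B P) -> (P : set (euclidean M)),
          (forall y, set_val (f y) = moment_map A (set_val (psi y))) /\
          homeomorphism f].
Proof.
have B_nondeg := hB.1.
have A_hyperplane : exists v0 r, r != 0 /\ forall a : A, B (val a) v0 = r.
  have [v0 [r [r0 Pr]]] := hP_hyperplane.
  by exists v0, r; split=> // a; apply/Pr/hAP/valP.
subst P.
have inj := toric_coords_inj B_nondeg A_hyperplane.
have rangeE := toric_coords_range B_nondeg A_hyperplane.
exists (@toric_coords R M N B A), (@torus_hom R M N B A); split=> //.
  split.
  - exact: toric_coords_continuous.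
  - exact: torus_hom_continuous.
  - exact: torus_homM.
  - exact: toric_coords_act.
pose Y := toric_variety B (normal_fan B (convex_hull [set` A])).
pose Q : set (euclidean M) := convex_hull [set` A].
pose f (y : Y) : Q := SigSub (mem_set (moment_map_toric_mem y)).
exists f; split=> //.
have f_surj (p : Q) : exists y, f y = p.
  have [z Zz zp] := moment_map_surj A_hyperplane B_nondeg (set_valP p).
  move: Zz; rewrite -rangeE => -[y _ yz]; exists y; apply: val_inj.
  by rewrite /= yz zp.
have [g fg] := choice f_surj.
exists g; split=> //; last first.
- move=> y; apply: (moment_map_toric_inj B_nondeg A_hyperplane).
  by have /(congr1 set_val) := fg (f y).
- move=> p; apply: (toric_coords_local_inverse B_nondeg A_hyperplane).
  apply: (@compact_lift_continuous Q {ptws A -> R} (euclidean M) (Z_variety B A)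
    (moment_map A) (fun p => set_val (toric_coords (g p))) set_val).
  + exact: euclidean_hausdorff.
  + exact: Z_variety_compact.
  + exact: moment_map_continuous.
  + exact: initial_continuous.
  + by move=> q; rewrite -rangeE; exists (g q).
  + by move=> q; have /(congr1 set_val) := fg q.
  move=> z z' /(Z_varietyP A_hyperplane B_nondeg)[zS [w [s zE]]].
  move=> /(Z_varietyP A_hyperplane B_nondeg)[z'S [w' [s' z'E]]].
  exact: (moment_map_inj zE z'E zS z'S).
apply: continuous_comp_initial => y.
apply: (@continuous_comp Y {ptws A -> R} (euclidean M)
  (fun y => set_val (toric_coords y)) (moment_map A)); last exact: moment_map_continuous.
apply: (@continuous_comp Y (simplex R A) {ptws A -> R}).
  exact: toric_coords_continuous.
exact: initial_continuous.
Qed.
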